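(* Let $\Bbbk$ be a field, let $\mathscr{C}$ be an abelian monoidal category and $\mathscr{M}$ an abelian left $\mathscr{C}$-module category. Suppose that the action functor $\triangleright\colon\mathscr{C}\otimes_\Bbbk\mathscr{M}\to\mathscr{M}$ is right exact in both variables, and let $T\colon\mathscr{M}\to\mathscr{M}$ be a right exact lax $\mathscr{C}$-module monad. Then there exists an essentially unique $\mathscr{C}$-module category structure on the Eilenberg–Moore category $\mathscr{M}^T$ such that the canonical inclusion $\iota\colon\mathscr{M}_T\to\mathscr{M}^T$ of the Kleisli category is a strong $\mathscr{C}$-module functor. (Essentially unique: any two left $\mathscr{C}$-module category structures on $\mathscr{M}^T$ for which $\iota$ is a strong $\mathscr{C}$-module functor give equivalent left $\mathscr{C}$-module categories.)
   Context: All categories and functors are $\Bbbk$-linear. A functor between abelian categories is right exact if it preserves finite colimits. $\mathscr{C}\otimes_\Bbbk\mathscr{M}$ is the $\Bbbk$-linear category whose objects are pairs $(x,m)$ and whose hom spaces are $\mathscr{C}(x,x')\otimes_\Bbbk\mathscr{M}(m,m')$. A lax $\mathscr{C}$-module functor $F$ is a functor with maps $F_{\mathsf a;x,m}\colon x\triangleright Fm\to F(x\triangleright m)$, natural in $x$ and $m$ and satisfying associativity and unitality conditions; it is strong if these maps are invertible. A lax $\mathscr{C}$-module monad on $\mathscr{M}$ is a monad $(T,\mu,\eta)$ on $\mathscr{M}$ with a lax $\mathscr{C}$-module structure $T_{\mathsf a;x,m}\colon x\triangleright Tm\to T(x\triangleright m)$ such that $\mu$ and $\eta$ are $\mathscr{C}$-module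 transformations (they commute with the module structure maps). The Eilenberg–Moore category $\mathscr{M}^T$ is the category of $T$-algebras $(m,\nabla_m\colon Tm\to m)$ and their morphisms. The Kleisli category $\mathscr{M}_T$ has the objects of $\mathscr{M}$ and $\mathscr{M}_T(m,n)=\mathscr{M}(m,Tn)$. It is a $\mathscr{C}$-module category via $x\triangleright_{\mathscr{M}_T}m=x\triangleright m$ on objects, and for $f\colon m\to Tn$, $x\triangleright_{\mathscr{M}_T}f$ is the composite $x\triangleright m\xrightarrow{x\triangleright f}x\triangleright Tn\xrightarrow{T_{\mathsf a;x,n}}T(x\triangleright n)$. The inclusion is given by $\iota(m)=(Tm,\mu_m)$ and $\iota(f\colon m\to Tn)=\mu_n\circ Tf$.
   Formalization: Uniqueness is claimed only among module structures on the Eilenberg–Moore category whose action is right exact in the Eilenberg–Moore variable; without this it fails (e.g. Id versus Id ⊕ Tor_1 on modules over k[e]/e²). Existence gives an action right exact in both variables. *)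

(* Defs.v *)
From HB Require Import structures.
From mathcomp Require Import all_boot all_algebra.

Set Implicit Arguments.
Unset Strict Implicit.
Unset Printing Implicit Defensive.

Import GRing.Theory.
Local Open Scope ring_scope.

Declare Scope lincat_scope.
Delimit Scope lincat_scope with lincat.

Record lincat (K : fieldType) := LinCat {
  ob :> Type;
  hom : ob -> ob -> lmodType K;
  idm : forall x, hom x x;
  cmp : forall x y z, hom y z -> hom x y -> hom x z;
  cmp_linl : forall x y z (a : K) (g g' : hom y z) (f : hom x y),
    cmp (a *: g + g') f = a *: cmp g f + cmp g' f;
  cmp_linr : forall x y z (a : K) (g : hom y z) (f f' : hom x y),
    cmp g (a *: f + f') = a *: cmp g f + cmp g f';
  cmpA : forall x y z w (h : hom z w) (g : hom y z) (f : hom x y),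
    cmp h (cmp g f) = cmp (cmp h g) f;
  cmp1f : forall x y (f : hom x y), cmp (idm y) f = f;
  cmpf1 : forall x y (f : hom x y), cmp f (idm x) = f
}.

Arguments hom {K l} x y.
Arguments idm {K l} x.
Arguments cmp {K l x y z} g f.

Notation "g \oc f" := (cmp g f) (at level 40, left associativity) : lincat_scope.
Local Open Scope lincat_scope.

Definition is_iso (K : fieldType) (A : lincat K) (x y : A) (f : hom x y) : Prop :=
  exists g : hom y x, g \oc f = idm x /\ f \oc g = idm y.

Record functor (K : fieldType) (A B : lincat K) := Functor {
  fob :> A -> B;
  fmap : forall x y, hom x y -> hom (fob x) (fob y);
  fmap_lin : forall x y (a : K) (f f' : hom x y),
    fmap (a *: f + f') = a *: fmap f + fmap f';
  fmap1 : forall x, fmap (idm x) = idm (fob x);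
  fmapM : forall x y z (g : hom y z) (f : hom x y),
    fmap (g \oc f) = fmap g \oc fmap f
}.

Arguments fmap {K A B} F {x y} f : rename.

Section FunctorOps.
Variables (K : fieldType) (A B C : lincat K).

Definition idfun_cat : functor A A :=
  @Functor K A A id (fun _ _ f => f) (fun _ _ _ _ _ => erefl) (fun _ => erefl)
    (fun _ _ _ _ _ => erefl).

Variables (G : functor B C) (F : functor A B).

Fact compfun_lin x y (a : K) (f f' : hom x y) :
  fmap G (fmap F (a *: f + f')) = a *: fmap G (fmap F f) + fmap G (fmap F f').
Proof. by rewrite !fmap_lin. Qed.

Fact compfun1 x : fmap G (fmap F (idm x)) = idm (G (F x)).
Proof. by rewrite !fmap1. Qed.

Fact compfunM x y z (g : hom y z) (f : hom x y) :
  fmap G (fmap F (g \oc f)) = fmap G (fmap F g) \oc fmap G (fmap F f).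
Proof. by rewrite !fmapM. Qed.

Definition compfun : functor A C :=
  @Functor K A C (fun x => G (F x)) (fun _ _ f => fmap G (fmap F f))
    compfun_lin compfun1 compfunM.

End FunctorOps.

Definition nat_isomorphic (K : fieldType) (A B : lincat K) (F G : functor A B) : Prop :=
  exists t : forall x, hom (F x) (G x),
    (forall x y (f : hom x y), t y \oc fmap F f = fmap G f \oc t x) /\
    (forall x, is_iso (t x)).

Definition is_equivalence (K : fieldType) (A B : lincat K) (F : functor A B) : Prop :=
  exists G : functor B A,
    nat_isomorphic (compfun G F) (idfun_cat A) /\
    nat_isomorphic (compfun F G) (idfun_cat B).

Record fincat := FinCat {
  fc_ob :> finType;
  fc_hom : fc_ob -> fc_ob -> finType;
  fc_id : forall i, fc_hom i i;
  fc_cmp : forall i j k, fc_hom j k -> fc_hom i j -> fc_hom i k;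
  fc_cmpA : forall i j k l (h : fc_hom k l) (g : fc_hom j k) (f : fc_hom i j),
    fc_cmp h (fc_cmp g f) = fc_cmp (fc_cmp h g) f;
  fc_cmp1f : forall i j (f : fc_hom i j), fc_cmp (fc_id j) f = f;
  fc_cmpf1 : forall i j (f : fc_hom i j), fc_cmp f (fc_id i) = f
}.

Record diagram (J : fincat) (K : fieldType) (A : lincat K) := Diagram {
  dob :> J -> A;
  dmap : forall i j, fc_hom i j -> hom (dob i) (dob j);
  dmap1 : forall i, dmap (fc_id i) = idm (dob i);
  dmapM : forall i j k (g : fc_hom j k) (f : fc_hom i j),
    dmap (fc_cmp g f) = dmap g \oc dmap f
}.

Arguments dmap {J K A} D {i j} f : rename.

Definition is_cocone (J : fincat) (K : fieldType) (A : lincat K) (D : diagram J A)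
    (c : A) (s : forall i, hom (D i) c) : Prop :=
  forall i j (f : fc_hom i j), s j \oc dmap D f = s i.

Definition is_colimit (J : fincat) (K : fieldType) (A : lincat K) (D : diagram J A)
    (c : A) (s : forall i, hom (D i) c) : Prop :=
  is_cocone s /\
  forall (d : A) (t : forall i, hom (D i) d), is_cocone t ->
    exists! u : hom c d, forall i, u \oc s i = t i.

Section MapDiagram.
Variables (J : fincat) (K : fieldType) (A B : lincat K).
Variables (F : functor A B) (D : diagram J A).

Fact map_diagram1 i : fmap F (dmap D (fc_id i)) = idm (F (D i)).
Proof. by rewrite dmap1 fmap1. Qed.

Fact map_diagramM i j k (g : fc_hom j k) (f : fc_hom i j) :
  fmap F (dmap D (fc_cmp g f)) = fmap F (dmap D g) \oc fmap F (dmap D f).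
Proof. by rewrite dmapM fmapM. Qed.

Definition map_diagram : diagram J B :=
  @Diagram J K B (fun i => F (D i)) (fun _ _ f => fmap F (dmap D f))
    map_diagram1 map_diagramM.

End MapDiagram.

Definition right_exact (K : fieldType) (A B : lincat K) (F : functor A B) : Prop :=
  forall (J : fincat) (D : diagram J A) (c : A) (s : forall i, hom (D i) c),
    is_colimit s ->
    is_colimit (D := map_diagram F D) (fun i => fmap F (s i)).

Section Abelian.
Variables (K : fieldType) (A : lincat K).

Definition is_zero_object (z : A) : Prop :=
  forall x : A, (forall f : hom x z, f = 0) /\ (forall f : hom z x, f = 0).

Definition is_biproduct (x y p : A) (i1 : hom x p) (i2 : hom y p)
    (p1 : hom p x) (p2 : hom p y) : Prop :=
  [/\ p1 \oc i1 = idm x, p2 \oc i2 = idm y, p1 \oc i2 = 0, p2 \oc i1 = 0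
    & i1 \oc p1 + i2 \oc p2 = idm p].

Definition is_mono (x y : A) (f : hom x y) : Prop :=
  forall (w : A) (g h : hom w x), f \oc g = f \oc h -> g = h.

Definition is_epi (x y : A) (f : hom x y) : Prop :=
  forall (w : A) (g h : hom y w), g \oc f = h \oc f -> g = h.

Definition is_kernel (x y k : A) (f : hom x y) (i : hom k x) : Prop :=
  f \oc i = 0 /\
  forall (w : A) (g : hom w x), f \oc g = 0 -> exists! u : hom w k, i \oc u = g.

Definition is_cokernel (x y c : A) (f : hom x y) (q : hom y c) : Prop :=
  q \oc f = 0 /\
  forall (w : A) (g : hom y w), g \oc f = 0 -> exists! u : hom c w, u \oc q = g.

Record abelian : Prop := Abelian {
  ab_zero : exists z, is_zero_object z;
  ab_biprod : forall x y : A, exists (p : A) (i1 : hom x p) (i2 : hom y p)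
    (p1 : hom p x) (p2 : hom p y), is_biproduct i1 i2 p1 p2;
  ab_ker : forall (x y : A) (f : hom x y),
    exists (k : A) (i : hom k x), is_kernel f i;
  ab_coker : forall (x y : A) (f : hom x y),
    exists (c : A) (q : hom y c), is_cokernel f q;
  ab_mono : forall (x y : A) (f : hom x y), is_mono f ->
    exists (z : A) (g : hom y z), is_kernel g f;
  ab_epi : forall (x y : A) (f : hom x y), is_epi f ->
    exists (z : A) (g : hom z x), is_cokernel g f
}.

End Abelian.

(* A linear functor out of the tensor product [A (x)_K B], whose hom spaces are
   [hom x x' (x)_K hom y y'], is the same thing as a functor of two variables
   that is K-bilinear on morphisms; the latter is what is recorded here.       *)
Record bifunctor (K : fieldType) (A B C : lincat K) := Bifunctor {
  bob :> A -> B -> C;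
  bmap : forall x x' y y', hom x x' -> hom y y' -> hom (bob x y) (bob x' y');
  bmap_linl : forall x x' y y' (a : K) (f f' : hom x x') (g : hom y y'),
    bmap (a *: f + f') g = a *: bmap f g + bmap f' g;
  bmap_linr : forall x x' y y' (a : K) (f : hom x x') (g g' : hom y y'),
    bmap f (a *: g + g') = a *: bmap f g + bmap f g';
  bmap1 : forall x y, bmap (idm x) (idm y) = idm (bob x y);
  bmapM : forall x x' x'' y y' y'' (f' : hom x' x'') (f : hom x x')
      (g' : hom y' y'') (g : hom y y'),
    bmap (f' \oc f) (g' \oc g) = bmap f' g' \oc bmap f g
}.

Arguments bmap {K A B C} P {x x' y y'} f g : rename.

Section PartialFunctors.
Variables (K : fieldType) (A B C : lincat K) (P : bifunctor A B C).

Fact bifunl_lin x y y' (a : K) (g g' : hom y y') :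
  bmap P (idm x) (a *: g + g') = a *: bmap P (idm x) g + bmap P (idm x) g'.
Proof. exact: bmap_linr. Qed.

Fact bifunlM x y y' y'' (g' : hom y' y'') (g : hom y y') :
  bmap P (idm x) (g' \oc g) = bmap P (idm x) g' \oc bmap P (idm x) g.
Proof. by rewrite -bmapM cmp1f. Qed.

Definition bifunl (x : A) : functor B C :=
  @Functor K B C (P x) (fun _ _ g => bmap P (idm x) g)
    (@bifunl_lin x) (fun y => bmap1 P x y) (@bifunlM x).

Fact bifunr_lin y x x' (a : K) (f f' : hom x x') :
  bmap P (a *: f + f') (idm y) = a *: bmap P f (idm y) + bmap P f' (idm y).
Proof. exact: bmap_linl. Qed.

Fact bifunrM y x x' x'' (f' : hom x' x'') (f : hom x x') :
  bmap P (f' \oc f) (idm y) = bmap P f' (idm y) \oc bmap P f (idm y).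
Proof. by rewrite -bmapM cmp1f. Qed.

Definition bifunr (y : B) : functor A C :=
  @Functor K A C (fun x => P x y) (fun _ _ f => bmap P f (idm y))
    (@bifunr_lin y) (fun x => bmap1 P x y) (@bifunrM y).

Definition right_exact_left_var : Prop := forall y : B, right_exact (bifunr y).
Definition right_exact_right_var : Prop := forall x : A, right_exact (bifunl x).

End PartialFunctors.

Record monoidal (K : fieldType) (C : lincat K) := Monoidal {
  tens : bifunctor C C C;
  munit : C;
  massoc : forall x y z, hom (tens (tens x y) z) (tens x (tens y z));
  mlunit : forall x, hom (tens munit x) x;
  mrunit : forall x, hom (tens x munit) x;
  massoc_nat : forall x x' y y' z z' (f : hom x x') (g : hom y y') (h : hom z z'),
    massoc x' y' z' \oc bmap tens (bmap tens f g) h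
    = bmap tens f (bmap tens g h) \oc massoc x y z;
  mlunit_nat : forall x x' (f : hom x x'),
    mlunit x' \oc bmap tens (idm munit) f = f \oc mlunit x;
  mrunit_nat : forall x x' (f : hom x x'),
    mrunit x' \oc bmap tens f (idm munit) = f \oc mrunit x;
  massoc_iso : forall x y z, is_iso (massoc x y z);
  mlunit_iso : forall x, is_iso (mlunit x);
  mrunit_iso : forall x, is_iso (mrunit x);
  mpentagon : forall w x y z,
    bmap tens (idm w) (massoc x y z) \oc massoc w (tens x y) z
      \oc bmap tens (massoc w x y) (idm z)
    = massoc w x (tens y z) \oc massoc (tens w x) y z;
  mtriangle : forall x y,
    bmap tens (idm x) (mlunit y) \oc massoc x munit y
    = bmap tens (mrunit x) (idm y)
}.

Record modcat (K : fieldType) (C : lincat K) (V : monoidal C) (M : lincat K) :=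
ModCat {
  act : bifunctor C M M;
  aassoc : forall x y m, hom (act (tens V x y) m) (act x (act y m));
  aunit : forall m, hom (act (munit V) m) m;
  aassoc_nat : forall x x' y y' m m' (f : hom x x') (g : hom y y') (h : hom m m'),
    aassoc x' y' m' \oc bmap act (bmap (tens V) f g) h
    = bmap act f (bmap act g h) \oc aassoc x y m;
  aunit_nat : forall m m' (f : hom m m'),
    aunit m' \oc bmap act (idm (munit V)) f = f \oc aunit m;
  aassoc_iso : forall x y m, is_iso (aassoc x y m);
  aunit_iso : forall m, is_iso (aunit m);
  apentagon : forall x y z m,
    bmap act (idm x) (aassoc y z m) \oc aassoc x (tens V y z) m
      \oc bmap act (massoc V x y z) (idm m)
    = aassoc x y (act z m) \oc aassoc (tens V x y) z m;
  atriangle : forall x m,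
    bmap act (idm x) (aunit m) \oc aassoc x (munit V) m
    = bmap act (mrunit V x) (idm m)
}.

Section ModuleFunctors.
Variables (K : fieldType) (C : lincat K) (V : monoidal C).

Record lax_modfun (M N : lincat K) (S : modcat V M) (S' : modcat V N)
    (F : functor M N) := LaxModFun {
  lax_map :> forall x m, hom (act S' x (F m)) (F (act S x m));
  lax_nat : forall x x' m m' (f : hom x x') (g : hom m m'),
    lax_map x' m' \oc bmap (act S') f (fmap F g)
    = fmap F (bmap (act S) f g) \oc lax_map x m;
  lax_assoc : forall x y m,
    fmap F (aassoc S x y m) \oc lax_map (tens V x y) m
    = lax_map x (act S y m) \oc bmap (act S') (idm x) (lax_map y m)
        \oc aassoc S' x y (F m);
  lax_unit : forall m,
    fmap F (aunit S m) \oc lax_map (munit V) m = aunit S' (F m)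
}.

Definition is_strong_modfun (M N : lincat K) (S : modcat V M) (S' : modcat V N)
    (F : functor M N) : Prop :=
  exists L : lax_modfun S S' F, forall x m, is_iso (L x m).

Definition modcat_equivalent (M N : lincat K) (S : modcat V M) (S' : modcat V N)
    : Prop :=
  exists F : functor M N, is_equivalence F /\ is_strong_modfun S S' F.

End ModuleFunctors.

Record monad (K : fieldType) (M : lincat K) := Monad {
  mfun :> functor M M;
  eta : forall m, hom m (mfun m);
  mu : forall m, hom (mfun (mfun m)) (mfun m);
  eta_nat : forall m n (f : hom m n), eta n \oc f = fmap mfun f \oc eta m;
  mu_nat : forall m n (f : hom m n),
    mu n \oc fmap mfun (fmap mfun f) = fmap mfun f \oc mu m;
  mu_assoc : forall m, mu m \oc fmap mfun (mu m) = mu m \oc mu (mfun m);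
  mu_etal : forall m, mu m \oc eta (mfun m) = idm (mfun m);
  mu_etar : forall m, mu m \oc fmap mfun (eta m) = idm (mfun m)
}.

(* The lax structure on the composite of [T] with itself has components
   [T (T_a) \oc T_a], and that on the identity functor has identity components. *)
Record lax_modmonad (K : fieldType) (C : lincat K) (V : monoidal C) (M : lincat K)
    (S : modcat V M) := LaxModMonad {
  lmm_monad :> monad M;
  lmm_lax : lax_modfun S S lmm_monad;
  mu_modtrans : forall x m,
    mu lmm_monad (act S x m)
      \oc (fmap lmm_monad (lmm_lax x m) \oc lmm_lax x (lmm_monad m))
    = lmm_lax x m \oc bmap (act S) (idm x) (mu lmm_monad m);
  eta_modtrans : forall x m,
    eta lmm_monad (act S x m) = lmm_lax x m \oc bmap (act S) (idm x) (eta lmm_monad m)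
}.

Section EilenbergMoore.
Variables (K : fieldType) (M : lincat K) (T : monad M).

Record algebra := Algebra {
  carrier : M;
  structure : hom (T carrier) carrier;
  alg_assoc : structure \oc mu T carrier = structure \oc fmap T structure;
  alg_unit : structure \oc eta T carrier = idm carrier
}.

Definition is_alg_morph (a b : algebra) : pred (hom (carrier a) (carrier b)) :=
  fun f => f \oc structure a == structure b \oc fmap T f.

Fact alg_morph_submod a b : submod_closed (@is_alg_morph a b).
Proof.
have cmp0 (x y z : M) (g : hom x y) : (0 : hom y z) \oc g = 0.
  by have := cmp_linl (-1) 0 (0 : hom y z) g; rewrite scaler0 addr0 scaleN1r addNr.
have cmp_0 (x y z : M) (g : hom y z) : g \oc (0 : hom x y) = 0.
  by have := cmp_linr (-1) g 0 (0 : hom x y); rewrite scaler0 addr0 scaleN1r addNr.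
have fmap0 (x y : M) : fmap T (0 : hom x y) = 0.
  by have := fmap_lin T (-1) 0 (0 : hom x y); rewrite scaler0 addr0 scaleN1r addNr.
split; first by rewrite unfold_in /is_alg_morph fmap0 cmp0 cmp_0.
move=> c f g; rewrite !unfold_in /is_alg_morph => /eqP ef /eqP eg.
by rewrite fmap_lin cmp_linl cmp_linr ef eg.
Qed.

HB.instance Definition _ a b :=
  GRing.isSubmodClosed.Build K (hom (carrier a) (carrier b)) (@is_alg_morph a b)
    (alg_morph_submod a b).

Record alg_hom (a b : algebra) := AlgHom {
  alg_val : hom (carrier a) (carrier b);
  alg_valP : is_alg_morph alg_val
}.

HB.instance Definition _ a b := [isSub for @alg_val a b].
HB.instance Definition _ a b := [Choice of alg_hom a b by <:].
HB.instance Definition _ a b := [SubChoice_isSubLmodule of alg_hom a b by <:].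

Lemma alg_homE a b (f : alg_hom a b) :
  alg_val f \oc structure a = structure b \oc fmap T (alg_val f).
Proof. exact/eqP/alg_valP. Qed.

Fact em_id_subproof a : is_alg_morph (idm (carrier a)).
Proof. by apply/eqP; rewrite fmap1 cmp1f cmpf1. Qed.

Definition em_id a : alg_hom a a := AlgHom (em_id_subproof a).

Fact em_cmp_subproof a b c (g : alg_hom b c) (f : alg_hom a b) :
  is_alg_morph (alg_val g \oc alg_val f).
Proof. by apply/eqP; rewrite fmapM -cmpA alg_homE !cmpA alg_homE. Qed.

Definition em_cmp a b c (g : alg_hom b c) (f : alg_hom a b) : alg_hom a c :=
  AlgHom (em_cmp_subproof g f).

Fact em_linl a b c (k : K) (g g' : alg_hom b c) (f : alg_hom a b) :
  em_cmp (k *: g + g') f = k *: em_cmp g f + em_cmp g' f.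
Proof. by apply: val_inj; apply: cmp_linl. Qed.

Fact em_linr a b c (k : K) (g : alg_hom b c) (f f' : alg_hom a b) :
  em_cmp g (k *: f + f') = k *: em_cmp g f + em_cmp g f'.
Proof. by apply: val_inj; apply: cmp_linr. Qed.

Fact em_cmpA a b c d (h : alg_hom c d) (g : alg_hom b c) (f : alg_hom a b) :
  em_cmp h (em_cmp g f) = em_cmp (em_cmp h g) f.
Proof. by apply: val_inj; apply: cmpA. Qed.

Fact em_cmp1f a b (f : alg_hom a b) : em_cmp (em_id b) f = f.
Proof. by apply: val_inj; apply: cmp1f. Qed.

Fact em_cmpf1 a b (f : alg_hom a b) : em_cmp f (em_id a) = f.
Proof. by apply: val_inj; apply: cmpf1. Qed.

Definition em : lincat K :=
  @LinCat K algebra alg_hom em_id em_cmp em_linl em_linr em_cmpA em_cmp1f em_cmpf1.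

End EilenbergMoore.

Section Kleisli.
Variables (K : fieldType) (M : lincat K) (T : monad M).

Definition kl_cmp (m n p : M) (g : hom n (T p)) (f : hom m (T n)) : hom m (T p) :=
  mu T p \oc fmap T g \oc f.

Fact kl_linl m n p (a : K) (g g' : hom n (T p)) (f : hom m (T n)) :
  kl_cmp (a *: g + g') f = a *: kl_cmp g f + kl_cmp g' f.
Proof. by rewrite /kl_cmp fmap_lin cmp_linr cmp_linl. Qed.

Fact kl_linr m n p (a : K) (g : hom n (T p)) (f f' : hom m (T n)) :
  kl_cmp g (a *: f + f') = a *: kl_cmp g f + kl_cmp g f'.
Proof. by rewrite /kl_cmp cmp_linr. Qed.

Fact kl_cmpA m n p q (h : hom p (T q)) (g : hom n (T p)) (f : hom m (T n)) :
  kl_cmp h (kl_cmp g f) = kl_cmp (kl_cmp h g) f.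
Proof.
rewrite /kl_cmp !fmapM !cmpA; congr (_ \oc _ \oc _).
by rewrite mu_assoc -(cmpA (mu T q) (fmap T h)) -mu_nat !cmpA.
Qed.

Fact kl_cmp1f m n (f : hom m (T n)) : kl_cmp (eta T n) f = f.
Proof. by rewrite /kl_cmp mu_etar cmp1f. Qed.

Fact kl_cmpf1 m n (f : hom m (T n)) : kl_cmp f (eta T m) = f.
Proof. by rewrite /kl_cmp -cmpA -eta_nat cmpA mu_etal cmp1f. Qed.

Definition kleisli : lincat K :=
  @LinCat K M (fun m n => hom m (T n)) (eta T) kl_cmp
    kl_linl kl_linr kl_cmpA kl_cmp1f kl_cmpf1.

Definition free_alg (m : M) : em T :=
  @Algebra K M T (T m) (mu T m) (esym (mu_assoc T m)) (mu_etal T m).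

Fact incl_map_subproof m n (f : hom m (T n)) :
  @is_alg_morph K M T (free_alg m) (free_alg n) (mu T n \oc fmap T f).
Proof.
apply/eqP; rewrite /= fmapM !cmpA mu_assoc.
by rewrite -!cmpA -mu_nat.
Qed.

Definition incl_map (m n : kleisli) (f : hom m n) : hom (free_alg m) (free_alg n) :=
  AlgHom (incl_map_subproof f).

Fact incl_lin (m n : kleisli) (a : K) (f f' : hom m n) :
  incl_map (a *: f + f') = a *: incl_map f + incl_map f'.
Proof. by apply: val_inj; rewrite /= fmap_lin cmp_linr. Qed.

Fact incl1 (m : kleisli) : incl_map (idm m) = idm (free_alg m).
Proof. by apply: val_inj; rewrite /= mu_etar. Qed.

Fact inclM (m n p : kleisli) (g : hom n p) (f : hom m n) :
  incl_map (g \oc f) = incl_map g \oc incl_map f.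
Proof.
apply: val_inj => /=; rewrite /kl_cmp !fmapM !cmpA mu_assoc.
by congr (_ \oc _); rewrite -!cmpA -mu_nat.
Qed.

Definition kleisli_incl : functor kleisli (em T) :=
  @Functor K kleisli (em T) free_alg incl_map incl_lin incl1 inclM.

End Kleisli.

Section KleisliModule.
Variables (K : fieldType) (C : lincat K) (V : monoidal C) (M : lincat K).
Variables (S : modcat V M) (T : lax_modmonad S).

(* On a pair (g, f) of a morphism of C and a Kleisli morphism; [g = idm x] gives
   [T_a \oc (x |> f)], while morphisms of C act through [M -> M_T], see
   [kl_act_eta].                                                               *)
Definition kl_act (x x' : C) (m m' : kleisli T) (g : hom x x') (f : hom m m') :
    hom (act S x m : kleisli T) (act S x' m') :=
  lmm_lax T x' m' \oc bmap (act S) g (f : @hom K M m (T m')).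

Lemma kl_cmp_eta m n p (g : hom n p) (f : hom m (T n)) :
  kl_cmp (eta T p \oc g) f = fmap T g \oc f.
Proof. by rewrite /kl_cmp fmapM cmpA mu_etar cmp1f. Qed.

Lemma kl_cmp_etar m n p (g : hom n (T p)) (f : hom m n) :
  kl_cmp g (eta T n \oc f) = g \oc f.
Proof. by rewrite /kl_cmp cmpA -(cmpA (mu T p)) -eta_nat cmpA mu_etal cmp1f. Qed.

Lemma kl_act_eta x x' (m m' : M) (g : hom x x') (f : hom m m') :
  @kl_act x x' m m' g (eta T m' \oc f) = eta T _ \oc bmap (act S) g f.
Proof. by rewrite /kl_act -[g in LHS]cmp1f bmapM cmpA -eta_modtrans. Qed.

Fact kl_act_linl x x' (m m' : kleisli T) (a : K) (g g' : hom x x') (f : hom m m') :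
  kl_act (a *: g + g') f = a *: kl_act g f + kl_act g' f.
Proof. by rewrite /kl_act bmap_linl cmp_linr. Qed.

Fact kl_act_linr x x' (m m' : kleisli T) (a : K) (g : hom x x') (f f' : hom m m') :
  kl_act g (a *: f + f') = a *: kl_act g f + kl_act g f'.
Proof. by rewrite /kl_act bmap_linr cmp_linr. Qed.

Fact kl_act1 x (m : kleisli T) :
  kl_act (idm x) (idm m) = idm (act S x m : kleisli T).
Proof. by rewrite /kl_act /= -eta_modtrans. Qed.

Fact kl_actM x x' x'' (m m' m'' : kleisli T) (g' : hom x' x'') (g : hom x x')
    (f' : hom m' m'') (f : hom m m') :
  kl_act (g' \oc g) (f' \oc f) = kl_act g' f' \oc kl_act g f.
Proof.
rewrite /kl_act /= /kl_cmp -[g' in LHS]cmp1f !bmapM !cmpA -mu_modtrans.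
congr (_ \oc _); rewrite fmapM !cmpA -[LHS]cmpA -[RHS]cmpA.
by rewrite lax_nat.
Qed.

Definition kl_bifunctor : bifunctor C (kleisli T) (kleisli T) :=
  @Bifunctor K C (kleisli T) (kleisli T) (act S) kl_act
    kl_act_linl kl_act_linr kl_act1 kl_actM.

Definition kl_assoc x y (m : kleisli T) :
    hom (kl_bifunctor (tens V x y) m) (kl_bifunctor x (kl_bifunctor y m)) :=
  eta T _ \oc aassoc S x y m.

Definition kl_unit (m : kleisli T) : hom (kl_bifunctor (munit V) m) m :=
  eta T m \oc aunit S m.

Lemma kl_iso_eta (m n : M) (f : hom m n) :
  is_iso f -> @is_iso K (kleisli T) m n (eta T n \oc f).
Proof.
by case=> g [gf fg]; exists (eta T m \oc g); split; rewrite /= kl_cmp_etar -cmpA;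
  rewrite ?gf ?fg cmpf1.
Qed.

Fact kl_assoc_nat x x' y y' (m m' : kleisli T) (f : hom x x') (g : hom y y')
    (h : hom m m') :
  kl_assoc x' y' m' \oc bmap kl_bifunctor (bmap (tens V) f g) h
  = bmap kl_bifunctor f (bmap kl_bifunctor g h) \oc kl_assoc x y m.
Proof.
rewrite /kl_assoc /= kl_cmp_eta kl_cmp_etar /kl_act cmpA lax_assoc.
rewrite -[f in RHS]cmp1f bmapM -!cmpA; congr (_ \oc (_ \oc _)).
exact: aassoc_nat.
Qed.

Fact kl_unit_nat (m m' : kleisli T) (f : hom m m') :
  kl_unit m' \oc bmap kl_bifunctor (idm (munit V)) f = f \oc kl_unit m.
Proof.
by rewrite /kl_unit /= kl_cmp_eta kl_cmp_etar /kl_act cmpA lax_unit aunit_nat.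
Qed.

Fact kl_pentagon x y z (m : kleisli T) :
  bmap kl_bifunctor (idm x) (kl_assoc y z m) \oc kl_assoc x (tens V y z) m
    \oc bmap kl_bifunctor (massoc V x y z) (idm m)
  = kl_assoc x y (kl_bifunctor z m) \oc kl_assoc (tens V x y) z m.
Proof.
rewrite /kl_assoc /= -[eta T m]cmpf1 !kl_act_eta !kl_cmp_etar -!cmpA.
by congr (_ \oc _); rewrite cmpA apentagon.
Qed.

Fact kl_triangle x (m : kleisli T) :
  bmap kl_bifunctor (idm x) (kl_unit m) \oc kl_assoc x (munit V) m
  = bmap kl_bifunctor (mrunit V x) (idm m).
Proof.
rewrite /kl_assoc /kl_unit /= -[eta T m in RHS]cmpf1 !kl_act_eta kl_cmp_etar.
by rewrite -cmpA atriangle.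
Qed.

Definition kleisli_modcat : modcat V (kleisli T) :=
  @ModCat K C V (kleisli T) kl_bifunctor kl_assoc kl_unit kl_assoc_nat kl_unit_nat
    (fun x y m => kl_iso_eta (aassoc_iso S x y m))
    (fun m => kl_iso_eta (aunit_iso S m))
    kl_pentagon kl_triangle.

End KleisliModule.

(* Main.v *)
Require Import Defs.
From HB Require Import structures.
From mathcomp Require Import all_boot all_algebra.
From Stdlib Require Import IndefiniteDescription.
(* Imported again, after the vector spaces, for [hom] to mean a hom space. *)
Require Import Defs.

Set Implicit Arguments.
Unset Strict Implicit.
Unset Printing Implicit Defensive.

Import GRing.Theory.
Local Open Scope ring_scope.
Local Open Scope lincat_scope.

(** The tensor product of modules over an algebra is characterised by bilinear
    maps, and so is the action on algebras over a monad. For an object [x] of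
    [C] and [T]-algebras [a], [b], call [g : x |> |a| -> |b|] bilinear when

      [g o (x |> structure a) = structure b o T g o T_a],

    where [T_a : x |> T m -> T (x |> m)] is the lax structure. The action
    [x |> a] has to be an algebra with a universal bilinear map
    [x |> |a| -> |x |> a|].

    Existence. A universal bilinear map is the same thing as a coequalizer of two
    morphisms of free algebras [T (x |> T |a|) => T (x |> |a|)]
    ([universal_coequalizer]). Coequalizers, and all finite colimits, exist in
    the category of algebras and are computed in [M], because [T] is right exact
    ([em_colimit], [forget_right_exact]). All the structure is induced by
    universality: a morphism out of [x |> a] is a bilinear map, so every
    coherence axiom reduces to the same axiom in [M]. The associator is
    invertible because the composite
    [(x (x) y) |> |a| -> x |> (y |> |a|) -> x |> |y |> a| -> |x |> (y |> a)|]
    is universal too ([universal_comp]); it is there that [x |> -] has to be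
    right exact on [M]. The unitor is invertible because
    [1 |> |a| -> |a|] is universal ([universal_unit]), and the inclusion of the
    Kleisli category is strong because [T_a] is universal for the free algebra
    [T m] ([universal_free]).

    In other words, the forgetful functor to [M] becomes a lax module functor
    with universal components; such a module structure is called corepresenting
    here. Two corepresenting structures are equivalent through the identity
    functor, since universal maps are unique up to isomorphism
    ([corep_equivalent]).

    Uniqueness. A structure that is right exact in [a] and for which the
    inclusion is strong is corepresenting ([strong_incl_corep]): [a] is the
    coequalizer of free algebras [T T |a| => T |a|], which [x |> -] preserves,
    and strength identifies the image of this pair with the pair
    [T (x |> T |a|) => T (x |> |a|)] above. *)

(** * Finite colimits in abelian categories *)

Section Categories.
Variables (K : fieldType) (A : lincat K).

(** Rewrites with [g o f = k] inside a composite nested to the right. *)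
Lemma cmp_eq (w x y z : A) (g : hom y z) (f : hom x y) (k : hom x z) (e : hom w x) :
  g \oc f = k -> g \oc (f \oc e) = k \oc e.
Proof. by rewrite cmpA => ->. Qed.

Lemma cmpBl (x y z : A) (g g' : hom y z) (f : hom x y) :
  (g - g') \oc f = g \oc f - g' \oc f.
Proof. by rewrite addrC -scaleN1r cmp_linl scaleN1r addrC. Qed.

Lemma cmpBr (x y z : A) (g : hom y z) (f f' : hom x y) :
  g \oc (f - f') = g \oc f - g \oc f'.
Proof. by rewrite addrC -scaleN1r cmp_linr scaleN1r addrC. Qed.

Lemma cmpDl (x y z : A) (g g' : hom y z) (f : hom x y) :
  (g + g') \oc f = g \oc f + g' \oc f.
Proof. by rewrite -[g]scale1r cmp_linl !scale1r. Qed.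

Lemma cmpDr (x y z : A) (g : hom y z) (f f' : hom x y) :
  g \oc (f + f') = g \oc f + g \oc f'.
Proof. by rewrite -[f]scale1r cmp_linr !scale1r. Qed.

Lemma cmp0f (x y z : A) (f : hom x y) : (0 : hom y z) \oc f = 0.
Proof. by rewrite -(subrr 0) cmpBl subrr. Qed.

Lemma cmpf0 (x y z : A) (g : hom y z) : g \oc (0 : hom x y) = 0.
Proof. by rewrite -(subrr 0) cmpBr subrr. Qed.

Definition is_coequalizer (x y c : A) (f g : hom x y) (e : hom y c) : Prop :=
  e \oc f = e \oc g /\
  forall (d : A) (t : hom y d), t \oc f = t \oc g ->
    exists! u : hom c d, u \oc e = t.

Lemma coequalizer_epi (x y c : A) (f g : hom x y) (e : hom y c) :
  is_coequalizer f g e -> is_epi e.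
Proof.
move=> [fg univ] w h h' hh'.
have [|u [_ uniq_u]] := univ w (h' \oc e); first by rewrite -!cmpA fg.
by rewrite -(uniq_u h hh') -(uniq_u h' erefl).
Qed.

Lemma coequalizer_iso (x y c x' y' : A) (f g : hom x y) (e : hom y c)
    (f' g' : hom x' y') (k : hom x' x) (j : hom y' y) :
  is_coequalizer f g e -> is_iso k -> is_iso j ->
  f \oc k = j \oc f' -> g \oc k = j \oc g' -> is_coequalizer f' g' (e \oc j).
Proof.
move=> [efg univ] [k' [_ kk']] [i [ij ji]] fk gk; split=> [|d t tfg].
  by rewrite -!cmpA -fk -gk !cmpA efg.
have [|u [ue uniq_u]] := univ d (t \oc i).
  rewrite -[LHS]cmpf1 -[RHS]cmpf1 -kk' !cmpA; congr (_ \oc _).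
  by rewrite -!cmpA fk gk !(cmp_eq _ ij) !cmp1f.
exists u; split; first by rewrite cmpA ue -cmpA ij cmpf1.
by move=> v vt; apply: uniq_u; rewrite -vt -!cmpA ji cmpf1.
Qed.

Lemma abelian_coequalizer (x y : A) (f g : hom x y) :
  abelian A -> exists (c : A) (e : hom y c), is_coequalizer f g e.
Proof.
move=> /ab_coker/(_ x y (f - g)) [c [e [efg univ]]]; exists c, e; split.
  by apply/eqP; rewrite -subr_eq0 -cmpBr efg.
by move=> d t tfg; apply: univ; rewrite cmpBr tfg subrr.
Qed.

(** Colimit legs are jointly epic: this is how equations between morphisms out
    of a colimit get proved. *)
Lemma colimit_ext (J : fincat) (D : diagram J A) (c : A)
    (s : forall i, hom (D i) c) :
  is_colimit s -> forall (d : A) (u v : hom c d),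
  (forall i, u \oc s i = v \oc s i) -> u = v.
Proof.
move=> [cos univ] d u v uv.
have [|w [_ uniq_w]] := univ d (fun i => v \oc s i).
  by move=> i j f; rewrite -cmpA cos.
by rewrite -(uniq_w u uv) -(uniq_w v (fun=> erefl)).
Qed.

Lemma colimit_desc (J : fincat) (D : diagram J A) (c : A)
    (s : forall i, hom (D i) c) :
  is_colimit s -> forall (d : A) (t : forall i, hom (D i) d), is_cocone t ->
  exists u : hom c d, forall i, u \oc s i = t i.
Proof. by move=> [_ univ] d t /univ [u [ut _]]; exists u. Qed.

Lemma colimitI (J : fincat) (D : diagram J A) (c : A)
    (s : forall i, hom (D i) c) :
  is_cocone s ->
  (forall d (t : forall i, hom (D i) d), is_cocone t ->
     exists u : hom c d, forall i, u \oc s i = t i) ->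
  (forall d (u v : hom c d), (forall i, u \oc s i = v \oc s i) -> u = v) ->
  is_colimit s.
Proof.
move=> cos desc ext; split=> // d t /desc [u ut].
by exists u; split=> // v vt; apply: ext => i; rewrite ut vt.
Qed.

Lemma colimit_iso (J : fincat) (D : diagram J A) (c c' : A)
    (s : forall i, hom (D i) c) (s' : forall i, hom (D i) c') (u : hom c c') :
  is_colimit s -> is_iso u -> (forall i, u \oc s i = s' i) -> is_colimit s'.
Proof.
move=> col [v [vu uv]] us; have [cos _] := col.
have vs i : v \oc s' i = s i by rewrite -us cmpA vu cmp1f.
apply: colimitI.
- by move=> i j f; rewrite -!us -cmpA cos.
- move=> d t /(colimit_desc col)[w ws]; exists (w \oc v) => i.
  by rewrite -cmpA vs.
move=> d w w' ww; rewrite -[w]cmpf1 -[w']cmpf1 -uv !cmpA; congr (_ \oc _).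
by apply: (colimit_ext col) => i; rewrite -!cmpA us.
Qed.

Lemma colimit_unique (J : fincat) (D : diagram J A) (c c' : A)
    (s : forall i, hom (D i) c) (s' : forall i, hom (D i) c') :
  is_colimit s -> is_colimit s' ->
  exists u : hom c c', is_iso u /\ forall i, u \oc s i = s' i.
Proof.
move=> col col'; have [cos _] := col; have [cos' _] := col'.
have [u us] := colimit_desc col cos'; have [v vs] := colimit_desc col' cos.
exists u; split=> //; exists v; split.
  by apply: (colimit_ext col) => i; rewrite cmp1f -cmpA us vs.
by apply: (colimit_ext col') => i; rewrite cmp1f -cmpA vs us.
Qed.

(** Coproducts of the [X i] for [i] in the sequence [r], one biproduct at a time.
    Injections and cocones are defined on all of [I], which spares a subtype; only
    their values on [r] are constrained. *)
Lemma finite_coproduct (I : eqType) (X : I -> A) (r : seq I) :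
  abelian A ->
  exists (p : A) (inj : forall i, hom (X i) p),
    (forall d (t : forall i, hom (X i) d),
       exists u : hom p d, forall i, i \in r -> u \oc inj i = t i) /\
    (forall d (u v : hom p d),
       (forall i, i \in r -> u \oc inj i = v \oc inj i) -> u = v).
Proof.
move=> abA; elim: r => [|i0 r [p [inj [desc ext]]]].
  have [z z0] := ab_zero abA; exists z, (fun=> 0); split=> [d t|d u v _].
    by exists 0.
  by rewrite (proj2 (z0 d) u) (proj2 (z0 d) v).
have [i0r|i0r] := boolP (i0 \in r).
  have sub i : i \in i0 :: r -> i \in r by rewrite inE => /orP[/eqP->|].
  exists p, inj; split=> [d t|d u v uv].
    by have [u ut] := desc d t; exists u => i /sub/ut.
  by apply: ext => i ir; apply: uv; rewrite inE ir orbT.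
have [b [i1 [i2 [p1 [p2 [e11 e22 e12 e21 e1]]]]]] := ab_biprod abA (X i0) p.
exists b, (dfwith (fun i => i2 \oc inj i) i1).
have out i : i \in r -> dfwith (fun i => i2 \oc inj i) i1 i = i2 \oc inj i.
  by move=> ir; apply: dfwith_out; apply: contraNneq i0r => ->.
split=> [d t|d u v uv].
  have [u ut] := desc d t; exists (t i0 \oc p1 + u \oc p2) => i; rewrite inE.
  case/predU1P=> [->|ir].
    by rewrite dfwith_in cmpDl -!cmpA e11 e21 cmpf1 cmpf0 addr0.
  rewrite out // cmpDl -!cmpA (cmp_eq _ e12) (cmp_eq _ e22) cmp0f cmpf0 add0r.
  by rewrite cmp1f ut.
have uv1 : u \oc i1 = v \oc i1 by have := uv i0 (mem_head _ _); rewrite dfwith_in.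
have uv2 : u \oc i2 = v \oc i2.
  apply: ext => i ir; have := uv i; rewrite inE ir orbT out // !cmpA.
  by apply.
by rewrite -[u]cmpf1 -[v]cmpf1 -e1 !cmpDr !cmpA uv1 uv2.
Qed.

(** Iterated coequalizers: dividing by one more relation preserves the earlier
    ones. *)
Lemma simultaneous_coequalizer (I : eqType) (X : I -> A) (p : A)
    (f g : forall i, hom (X i) p) (r : seq I) :
  abelian A ->
  exists (c : A) (e : hom p c),
    [/\ forall i, i \in r -> e \oc f i = e \oc g i,
        forall d (t : hom p d), (forall i, i \in r -> t \oc f i = t \oc g i) ->
          exists u : hom c d, u \oc e = t
      & is_epi e].
Proof.
move=> abA; elim: r => [|i0 r [c [e [efg desc epi]]]].
  exists p, (idm p); split=> // [d t _|w g1 g2]; first by exists t; rewrite cmpf1.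
  by rewrite !cmpf1.
have [c' [e' coeq]] := abelian_coequalizer (e \oc f i0) (e \oc g i0) abA.
have epi' := coequalizer_epi coeq; case: coeq => e'fg desc'.
exists c', (e' \oc e); split=> [i|d t tfg|w g1 g2].
- rewrite inE => /predU1P[->|ir]; first by rewrite -!cmpA.
  by rewrite -!cmpA efg.
- have [|u ue] := desc d t; first by move=> i ir; rewrite tfg ?inE ?ir ?orbT.
  have [|v [ve _]] := desc' d u; first by rewrite !cmpA ue tfg ?mem_head.
  by exists v; rewrite cmpA ve.
by rewrite !cmpA => /epi/epi'.
Qed.

(** The coproduct of all objects of the diagram, divided by the relations
    expressing compatibility with each of its arrows. *)
Lemma abelian_colimit (J : fincat) (D : diagram J A) :
  abelian A -> exists (c : A) (s : forall i, hom (D i) c), is_colimit s.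
Proof.
move=> abA.
have [p [inj [desc ext]]] := finite_coproduct (fun i : J => D i) (enum J) abA.
pose arr := {ij : J * J & fc_hom ij.1 ij.2}.
have [c [e [er desce epi]]] := simultaneous_coequalizer
  (fun r : arr => inj (tag r).2 \oc dmap D (tagged r))
  (fun r : arr => inj (tag r).1) (enum {: arr}) abA.
exists c, (fun i => e \oc inj i); apply: colimitI.
- move=> i j f; rewrite -cmpA.
  exact: (er (existT (fun ij : J * J => fc_hom ij.1 ij.2) (i, j) f)
             (mem_enum _ _)).
- move=> d t cot; have [u ut] := desc d t.
  have utE i : u \oc inj i = t i by apply: ut; rewrite mem_enum.
  have [|v ve] := desce d u.
    by move=> [[i j] f] _ /=; rewrite cmpA !utE; apply: cot.
  by exists v => i; rewrite cmpA ve.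
move=> d u v uv; apply: epi; apply: ext => i _.
by rewrite -!cmpA.
Qed.

End Categories.

(** * Coequalizers as colimits *)

Definition pair_hom (i j : bool) : finType :=
  match i, j return finType with
  | false, true => bool
  | true, false => void
  | _, _ => unit
  end.

Definition pair_id i : pair_hom i i :=
  match i return pair_hom i i with true => tt | false => tt end.

Definition pair_cmp i j k : pair_hom j k -> pair_hom i j -> pair_hom i k :=
  match i, j, k return pair_hom j k -> pair_hom i j -> pair_hom i k with
  | false, false, false => fun _ _ => tt
  | false, false, true => fun g _ => g
  | false, true, true => fun _ f => f
  | true, true, true => fun _ _ => tt
  | true, false, _ => fun _ f => match f with end
  | _, true, false => fun g _ => match g with end
  end.

Fact pair_cmpA i j k l (h : pair_hom k l) (g : pair_hom j k) (f : pair_hom i j) :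
  pair_cmp h (pair_cmp g f) = pair_cmp (pair_cmp h g) f.
Proof. by move: i j k l h g f => [] [] [] [] //= [] // [] // []. Qed.

Fact pair_cmp1f i j (f : pair_hom i j) : pair_cmp (pair_id j) f = f.
Proof. by move: i j f => [] [] // []. Qed.

Fact pair_cmpf1 i j (f : pair_hom i j) : pair_cmp f (pair_id i) = f.
Proof. by move: i j f => [] [] // []. Qed.

(** The category with two objects and two parallel arrows between them. *)
Definition pair_cat : fincat :=
  @FinCat bool pair_hom pair_id pair_cmp pair_cmpA pair_cmp1f pair_cmpf1.

Section ParallelPair.
Variables (K : fieldType) (A : lincat K) (x y : A) (f g : hom x y).

Definition pair_ob (i : pair_cat) : A := if i is true then y else x.

Definition pair_map (i j : pair_cat) : fc_hom i j -> hom (pair_ob i) (pair_ob j) :=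
  match i, j return fc_hom (i : pair_cat) j -> hom (pair_ob i) (pair_ob j) with
  | false, false => fun _ => idm x
  | false, true => fun b => if b is true then f else g
  | true, true => fun _ => idm y
  | true, false => fun v => match v with end
  end.

Fact pair_map1 i : pair_map (fc_id i) = idm (pair_ob i).
Proof. by case: i. Qed.

Fact pair_mapM i j k (h : fc_hom j k) (l : fc_hom i j) :
  pair_map (fc_cmp h l) = pair_map h \oc pair_map l.
Proof.
by move: i j k h l => [] [] [] //= h l; rewrite ?cmp1f ?cmpf1 //; case: h l.
Qed.

Definition pair_diagram : diagram pair_cat A := Diagram pair_map1 pair_mapM.

Definition pair_cocone (c : A) (e : hom y c) (i : pair_cat) : hom (pair_ob i) c :=
  match i return hom (pair_ob i) c with true => e | false => e \oc f end.

Lemma coequalizer_colimit (c : A) (e : hom y c) :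
  is_coequalizer f g e -> is_colimit (D := pair_diagram) (pair_cocone e).
Proof.
move=> co; have epi := coequalizer_epi co; case: co => efg univ.
apply: colimitI => [i j h|d t cot|d u v uv]; last exact: epi (uv true).
  by case: i j h => [] [] //= [] //; rewrite cmpf1.
have tf : t true \oc f = t false by exact: (cot false true true).
have tg : t true \oc g = t false by exact: (cot false true false).
have [|u [ue _]] := univ d (t true); first by rewrite tf tg.
by exists u => -[] /=; rewrite ?cmpA ue.
Qed.

End ParallelPair.

Lemma colimit_coequalizer (K : fieldType) (A B : lincat K) (F : functor A B)
    (x y : A) (c : B) (f g : hom x y)
    (s : forall i, hom (map_diagram F (pair_diagram f g) i) c) :
  is_colimit s -> is_coequalizer (fmap F f) (fmap F g) (s true).
Proof.
move=> col; have [cos _] := col; split=> [|d t tfg].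
  by rewrite [LHS](cos false true true) [RHS](cos false true false).
pose t' (i : pair_cat) : hom (map_diagram F (pair_diagram f g) i) d :=
  match i return hom (F (pair_ob x y i)) d with
  | true => t | false => t \oc fmap F f end.
have [|u ut] := colimit_desc col (t := t').
  by move=> [] [] //= [] //=; rewrite fmap1 cmpf1.
exists u; split; first exact: (ut true).
move=> v ve; apply: (colimit_ext col) => i; rewrite ut.
case: i => //; rewrite -[s false](cos false true true) cmpA.
by rewrite ve.
Qed.

Lemma right_exact_coequalizer (K : fieldType) (A B : lincat K) (F : functor A B)
    (x y c : A) (f g : hom x y) (e : hom y c) :
  right_exact F -> is_coequalizer f g e ->
  is_coequalizer (fmap F f) (fmap F g) (fmap F e).
Proof. by move=> rexF /coequalizer_colimit/rexF/colimit_coequalizer. Qed.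

(** * Colimits and presentations of algebras *)

Section EilenbergMooreColimits.
Variables (K : fieldType) (M : lincat K) (T : monad M).
Implicit Types (a b c : em T).

Definition forget : functor (em T) M :=
  @Functor K (em T) M (@carrier K M T) (fun a b (f : alg_hom a b) => alg_val f)
    (fun _ _ _ _ _ => erefl) (fun _ => erefl) (fun _ _ _ _ _ => erefl).

Lemma em_ext a b (f g : hom a b) : alg_val f = alg_val g -> f = g.
Proof. exact: val_inj. Qed.

Lemma alg_valM a b c (g : hom b c) (f : hom a b) :
  alg_val (g \oc f) = alg_val g \oc alg_val f.
Proof. by []. Qed.

Lemma alg_val1 a : alg_val (idm a) = idm (carrier a).
Proof. by []. Qed.

Lemma alg_homI a b (f : hom (carrier a) (carrier b)) :
  f \oc structure a = structure b \oc fmap T f ->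
  exists h : hom a b, alg_val h = f.
Proof. by move=> /eqP ef; exists (AlgHom ef). Qed.

Definition counit a : hom (free_alg T (carrier a)) a :=
  @AlgHom K M T (free_alg T (carrier a)) a (structure a)
    (introT eqP (alg_assoc a)).

Definition free_ext a (n : M) (g : hom n (carrier a)) : hom (free_alg T n) a :=
  counit a \oc incl_map (eta T (carrier a) \oc g : hom (n : kleisli T) _).

Lemma free_extE a (n : M) (g : hom n (carrier a)) :
  alg_val (free_ext g) = structure a \oc fmap T g.
Proof. by rewrite /= fmapM (cmpA (mu T _)) mu_etar cmp1f. Qed.

Lemma free_ext_eta a (n : M) (g : hom n (carrier a)) :
  alg_val (free_ext g) \oc eta T n = g.
Proof. by rewrite free_extE -cmpA -eta_nat cmpA alg_unit cmp1f. Qed.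

Lemma free_hom_ext a (n : M) (f g : hom (free_alg T n) a) :
  alg_val f \oc eta T n = alg_val g \oc eta T n -> f = g.
Proof.
have key (h : hom (free_alg T n) a) :
    alg_val h = structure a \oc fmap T (alg_val h \oc eta T n).
  by rewrite fmapM cmpA -alg_homE -cmpA mu_etar cmpf1.
by move=> fg; apply: em_ext; rewrite key fg -key.
Qed.

(** As [T] preserves the colimit [c] of the underlying diagram, the structures of
    the [D i] induce a map [T c -> c]; as [T o T] preserves it too, associativity
    can be tested on the legs. *)
Lemma em_colimit (J : fincat) (D : diagram J (em T)) :
  abelian M -> right_exact T ->
  exists (c : em T) (s : forall i, hom (D i) c),
    is_colimit s /\ is_colimit (D := map_diagram forget D) (fun i => alg_val (s i)).
Proof.
move=> abM rexT.
have [c [s col]] := abelian_colimit (map_diagram forget D) abM.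
have colT := rexT _ _ _ _ col; have colTT := rexT _ _ _ _ colT.
have [cos _] := col.
have [|str strE] := colimit_desc colT (t := fun i => s i \oc structure (D i)).
  move=> i j f /=; rewrite -cmpA -alg_homE cmpA.
  by congr (_ \oc _); apply: cos.
have strA : str \oc mu T c = str \oc fmap T str.
  apply: (colimit_ext colTT) => i /=.
  rewrite -!cmpA mu_nat -fmapM strE cmpA strE fmapM cmpA strE -!cmpA.
  by rewrite alg_assoc.
have str1 : str \oc eta T c = idm c.
  apply: (colimit_ext col) => i /=.
  by rewrite -cmpA eta_nat cmpA strE -cmpA alg_unit cmpf1 cmp1f.
pose ca : em T := Algebra strA str1.
have smorph i : @is_alg_morph K M T (D i) ca (s i) by apply/eqP; rewrite /= strE.
exists ca, (fun i => AlgHom (smorph i)); split=> //.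
apply: colimitI.
- by move=> i j f; apply: em_ext; apply: cos.
- move=> d t cot.
  have [|u us] := colimit_desc col (t := fun i => alg_val (t i)).
    by move=> i j f; rewrite -(cot i j f).
  have [|h hu] := @alg_homI ca d u.
    apply: (colimit_ext colT) => i /=.
    by rewrite -!cmpA strE cmpA us alg_homE -us fmapM.
  by exists h => i; apply: em_ext; rewrite alg_valM hu us.
move=> d u v uv; apply: em_ext; apply: (colimit_ext col) => i.
exact: (congr1 (@alg_val _ _ _ _ _) (uv i)).
Qed.

(** A colimit of algebras is isomorphic to the one above, which is computed in
    [M]. *)
Lemma forget_right_exact : abelian M -> right_exact T -> right_exact forget.
Proof.
move=> abM rexT J D c s col.
have [c' [s' [col' colU']]] := em_colimit D abM rexT.
have [u [[v [vu uv]] us]] := colimit_unique col' col.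
apply: (colimit_iso (u := alg_val u) colU').
  by exists (alg_val v); rewrite -!alg_valM vu uv.
by move=> i; rewrite -[in RHS]us.
Qed.

(** The pair consists of [T (structure a)] and [mu]; a morphism [t] coequalizing
    it factors through [t o eta]. Writing the pair as the image of two Kleisli
    morphisms lets a strong inclusion carry the action across it. *)
Lemma counit_coequalizer a :
  is_coequalizer
    (incl_map (eta T (carrier a) \oc structure a :
       hom (T (carrier a) : kleisli T) (carrier a)))
    (incl_map (idm (T (carrier a)) :
       hom (T (carrier a) : kleisli T) (carrier a)))
    (counit a).
Proof.
split=> [|d t].
  apply: em_ext; rewrite !alg_valM /= fmapM (cmpA (mu T _)) mu_etar cmp1f.
  rewrite fmap1 cmpf1.
  by rewrite alg_assoc.
move=> /(congr1 (@alg_val _ _ _ _ _)).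
rewrite !alg_valM /= fmapM (cmpA (mu T _)) mu_etar cmp1f fmap1 cmpf1 => tE.
have [|u uE] := @alg_homI a d (alg_val t \oc eta T (carrier a)).
  rewrite -cmpA eta_nat cmpA tE -cmpA mu_etal fmapM cmpA.
  by rewrite -alg_homE -cmpA mu_etar.
exists u; split.
  apply: free_hom_ext; rewrite alg_valM uE /= -!cmpA alg_unit.
  by rewrite cmpf1.
move=> v vt; apply: em_ext; rewrite uE -vt alg_valM /= -cmpA alg_unit.
by rewrite cmpf1.
Qed.

End EilenbergMooreColimits.

Arguments forget {K M} T.
Arguments counit {K M T} a.

(** * Bilinear maps *)

Section Bilinear.
Variables (K : fieldType) (C : lincat K) (V : monoidal C) (M : lincat K).
Variables (S : modcat V M) (T : lax_modmonad S).
Implicit Types (x y : C) (a b c p : em T).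

Local Notation "f |> g" := (bmap (act S) f g) (at level 39).
Local Notation "1_ x" := (idm x) (at level 2, x at level 2, format "1_ x").
Local Notation Ta := (lmm_lax T).

Lemma actM x (m n k : M) (g : hom n k) (f : hom m n) :
  1_x |> (g \oc f) = (1_x |> g) \oc (1_x |> f).
Proof. exact: (bifunlM (act S)). Qed.

Lemma act_swap x x' (m n k : M) (f : hom x x') (g : hom n k) (h : hom m n) :
  (f |> g) \oc (1_x |> h) = f |> (g \oc h).
Proof. by rewrite -bmapM cmpf1. Qed.

Lemma act_swapl x x' (m n k : M) (f : hom x x') (g : hom n k) (h : hom m n) :
  (1_x' |> g) \oc (f |> h) = f |> (g \oc h).
Proof. by rewrite -bmapM cmp1f. Qed.

(** Both sides are maps [x |> T |a| -> |b|]: the structure of [a] may be applied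
    before [g], or that of [b] after it. For [x] the unit object this says that
    [g] is a morphism of algebras, up to the unit constraint. *)
Definition bilin x a b (g : hom (act S x (carrier a)) (carrier b)) : Prop :=
  g \oc (1_x |> structure a) = structure b \oc (fmap T g \oc Ta x (carrier a)).

Lemma bilin_comp_alg x a b c (h : hom b c)
    (g : hom (act S x (carrier a)) (carrier b)) :
  bilin g -> bilin (alg_val h \oc g).
Proof.
rewrite /bilin => bg; rewrite -cmpA bg cmpA alg_homE.
by rewrite fmapM -!cmpA.
Qed.

Lemma bilin_comp_act x x' a a' b (f : hom x x') (h : hom a a')
    (g : hom (act S x' (carrier a')) (carrier b)) :
  bilin g -> bilin (g \oc (f |> alg_val h)).
Proof.
rewrite /bilin => bg; rewrite -cmpA act_swap alg_homE -act_swapl cmpA bg.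
rewrite -!cmpA lax_nat; congr (_ \oc _).
by rewrite fmapM -!cmpA.
Qed.

(** The image under the action of [x] on Kleisli morphisms of the two maps that
    present [a]; a right exact action with a strong inclusion has to send [a] to
    their coequalizer. *)
Definition presl x a :
    hom (free_alg T (act S x (T (carrier a)))) (free_alg T (act S x (carrier a))) :=
  fmap (kleisli_incl T) (bmap (kl_bifunctor T) 1_x
    (eta T (carrier a) \oc structure a :
       hom (T (carrier a) : kleisli T) (carrier a))).

Definition presr x a :
    hom (free_alg T (act S x (T (carrier a)))) (free_alg T (act S x (carrier a))) :=
  fmap (kleisli_incl T) (bmap (kl_bifunctor T) 1_x
    (idm (T (carrier a)) : hom (T (carrier a) : kleisli T) (carrier a))).

Lemma preslE x a : alg_val (presl x a) = fmap T (1_x |> structure a).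
Proof. by rewrite /= kl_act_eta fmapM cmpA mu_etar cmp1f. Qed.

Lemma presrE x a : alg_val (presr x a) = mu T _ \oc fmap T (Ta x (carrier a)).
Proof. by rewrite /= /kl_act bmap1 cmpf1. Qed.

(** Restricted along [eta], the two composites are the two sides of the equation
    that defines bilinearity. *)
Lemma bilin_pres x a b (g : hom (act S x (carrier a)) (carrier b)) :
  bilin g <-> free_ext g \oc presl x a = free_ext g \oc presr x a.
Proof.
have key k : alg_val (free_ext g \oc
    fmap (kleisli_incl T) (k : hom (act S x (T (carrier a)) : kleisli T) _))
    \oc eta T _ = structure b \oc (fmap T g \oc k).
  rewrite alg_valM free_extE /= -!cmpA; congr (_ \oc (_ \oc _)).
  by rewrite -eta_nat cmpA mu_etal cmp1f.
have keyl : alg_val (free_ext g \oc presl x a) \oc eta T _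
    = g \oc (1_x |> structure a).
  rewrite key [bmap _ _ _]kl_act_eta (cmpA (fmap T g)) -eta_nat -cmpA.
  by rewrite cmpA alg_unit cmp1f.
have keyr : alg_val (free_ext g \oc presr x a) \oc eta T _
    = structure b \oc (fmap T g \oc Ta x (carrier a)).
  by rewrite key /= /kl_act bmap1 cmpf1.
split=> [bg|E].
  by apply: free_hom_ext; rewrite keyl keyr bg.
by rewrite /bilin -keyl -keyr E.
Qed.

Definition universal x a p (q : hom (act S x (carrier a)) (carrier p)) : Prop :=
  bilin q /\ forall b (g : hom (act S x (carrier a)) (carrier b)), bilin g ->
    exists! h : hom p b, alg_val h \oc q = g.

Lemma universal_ext x a p (q : hom (act S x (carrier a)) (carrier p)) b
    (h h' : hom p b) :
  universal q -> alg_val h \oc q = alg_val h' \oc q -> h = h'.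
Proof.
move=> [bq univ] hh; have [u [_ uniq_u]] := univ b _ (bilin_comp_alg h' bq).
by rewrite -(uniq_u h hh) -(uniq_u h' erefl).
Qed.

Lemma universal_iso x a p p' (q : hom (act S x (carrier a)) (carrier p))
    (q' : hom (act S x (carrier a)) (carrier p')) (h : hom p p') :
  universal q -> universal q' -> alg_val h \oc q = q' -> is_iso h.
Proof.
move=> uq uq' hq; have [k [kq _]] := proj2 uq' p q (proj1 uq).
exists k; split.
  by apply: (universal_ext uq); rewrite alg_valM -cmpA hq kq alg_val1 cmp1f.
by apply: (universal_ext uq'); rewrite alg_valM -cmpA kq hq alg_val1 cmp1f.
Qed.

Lemma universal_coequalizer x a p (q : hom (act S x (carrier a)) (carrier p)) :
  universal q <-> is_coequalizer (presl x a) (presr x a) (free_ext q).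
Proof.
have free_ext_val b (h : hom p b) : h \oc free_ext q = free_ext (alg_val h \oc q).
  by apply: free_hom_ext; rewrite alg_valM -cmpA !free_ext_eta.
have freeK b (t : hom (free_alg T (act S x (carrier a))) b) :
    free_ext (alg_val t \oc eta T _) = t.
  by apply: free_hom_ext; rewrite free_ext_eta.
split=> [uq|co].
  split=> [|b t]; first exact/bilin_pres/(proj1 uq).
  rewrite -(freeK b t) => /bilin_pres/(proj2 uq)[u [ut uniq_u]].
  exists u; split; first by rewrite free_ext_val ut.
  move=> v; rewrite free_ext_val freeK => vt; apply: uniq_u.
  by rewrite -vt free_ext_eta.
have epi := coequalizer_epi co; case: co => pq univ; split; first exact/bilin_pres.
move=> b g /bilin_pres/univ[u [ug uniq_u]]; exists u; split.
  by rewrite -(free_ext_eta q) cmpA -alg_valM ug free_ext_eta.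
by move=> v vg; apply: uniq_u; rewrite free_ext_val vg.
Qed.

(** A bilinear map [g] out of [x |> T m] is determined by its restriction
    [g o (x |> eta)] to [x |> m], whose extension to [T (x |> m)] recovers it. *)
Lemma universal_free x (m : M) :
  @universal x (free_alg T m) (free_alg T (act S x m)) (Ta x m).
Proof.
have bTa : @bilin x (free_alg T m) (free_alg T (act S x m)) (Ta x m).
  by rewrite /bilin /= mu_modtrans.
split=> // b g bg; exists (free_ext (g \oc (1_x |> eta T m))); split.
  rewrite free_extE fmapM -!cmpA -lax_nat (cmpA (fmap T g)) cmpA -bg -cmpA.
  by rewrite -actM /= mu_etar bmap1 cmpf1.
move=> h hg; apply: free_hom_ext; rewrite free_ext_eta -hg -cmpA.
by rewrite -eta_modtrans.
Qed.

(** Transported along the unit constraint, bilinear maps out of [1 |> a] become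
    algebra morphisms out of [a]. *)
Lemma universal_unit a : @universal (munit V) a a (aunit S (carrier a)).
Proof.
have bu : @bilin (munit V) a a (aunit S (carrier a)).
  by rewrite /bilin aunit_nat -(lax_unit Ta).
split=> // b g bg; have [v [vu uv]] := aunit_iso S (carrier a).
have [|h hE] := @alg_homI _ _ T a b (g \oc v).
  have [w [_ uw]] := aunit_iso S (T (carrier a)).
  rewrite -[LHS]cmpf1 -[RHS]cmpf1 -uw !cmpA; congr (_ \oc w).
  rewrite -!cmpA -aunit_nat (cmpA v) vu cmp1f bg.
  by rewrite -(lax_unit Ta) fmapM -!cmpA (cmpA (fmap T v)) -fmapM vu fmap1 cmp1f.
exists h; split; first by rewrite hE -cmpA vu cmpf1.
by move=> k kg; apply: em_ext; rewrite hE -kg -cmpA uv cmpf1.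
Qed.

Lemma assoc_natr x y (m n : M) (h : hom m n) :
  aassoc S x y n \oc (1_(tens V x y) |> h) = (1_x |> (1_y |> h)) \oc aassoc S x y m.
Proof. by rewrite -aassoc_nat bmap1. Qed.

Section Composition.
Hypotheses (rexA : right_exact_right_var (act S)) (rexT : right_exact T).
Hypothesis (rexU : right_exact (forget T)).

(** A map [g] on [x |> (y |> |a|)] that is linear in [a] extends to
    [x |> T (y |> |a|)], and descends from there to [x |> |p|] because [x |> -]
    and the forgetful functor preserve the coequalizer that presents [p]. *)
Lemma universal_uncurry x y a p (q : hom (act S y (carrier a)) (carrier p)) b
    (g : hom (act S x (act S y (carrier a))) (carrier b)) :
  universal q ->
  g \oc (1_x |> (1_y |> structure a))
    = structure b \oc (fmap T g \oc (Ta x _ \oc (1_x |> Ta y (carrier a)))) ->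
  exists h : hom (act S x (carrier p)) (carrier b), bilin h /\ h \oc (1_x |> q) = g.
Proof.
move=> /universal_coequalizer co lin.
have coU := right_exact_coequalizer rexU co.
have := right_exact_coequalizer (rexA x) coU.
rewrite [fmap (forget T) _]preslE [fmap (forget T) _]presrE.
rewrite [fmap (forget T) _]free_extE /= => coA.
have epiT := coequalizer_epi (right_exact_coequalizer (rexA x)
  (right_exact_coequalizer rexT coU)).
rewrite [fmap (forget T) _]free_extE /= in epiT.
(* The extension of [g] along [x |> eta : x |> (y |> a) -> x |> T (y |> a)]. *)
pose g1 := structure b \oc (fmap T g \oc Ta x (act S y (carrier a))).
have g1mu : g1 \oc (1_x |> mu T _) =
    structure b \oc (fmap T g1 \oc Ta x (T (act S y (carrier a)))).
  rewrite /g1 -!cmpA -mu_modtrans (cmp_eq _ (esym (mu_nat T g))).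
  by rewrite !fmapM -!cmpA (cmp_eq _ (alg_assoc b)) -!cmpA.
have [|h [hE _]] := proj2 coA _ g1.
  rewrite actM (cmpA g1) g1mu /g1 -!cmpA !lax_nat.
  by rewrite !(cmpA (fmap T _)) -!fmapM lin -!cmpA.
have hq : h \oc (1_x |> q) = g.
  rewrite -[q](free_ext_eta (a := p)) free_extE actM cmpA hE /g1.
  rewrite -!cmpA -eta_modtrans -eta_nat.
  by rewrite cmpA alg_unit cmp1f.
exists h; split=> //; apply: epiT.
have qmu : structure p \oc fmap T (structure p \oc fmap T q)
    = structure p \oc fmap T q \oc mu T _.
  by rewrite fmapM cmpA -alg_assoc -!cmpA mu_nat.
rewrite -!cmpA lax_nat (cmpA (fmap T h)) -fmapM hE -g1mu -hE.
by rewrite -actM qmu actM cmpA.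
Qed.

Lemma universal_uncurry_ext x y a p (q : hom (act S y (carrier a)) (carrier p)) b
    (h h' : hom (act S x (carrier p)) (carrier b)) :
  universal q -> bilin h -> bilin h' ->
  h \oc (1_x |> q) = h' \oc (1_x |> q) -> h = h'.
Proof.
move=> /universal_coequalizer co bh bh' hh.
have := coequalizer_epi (right_exact_coequalizer (rexA x)
  (right_exact_coequalizer rexU co)).
rewrite [fmap (forget T) _]free_extE /= => epi; apply: epi.
rewrite actM !cmpA bh bh' -!cmpA !lax_nat !(cmpA (fmap T _)) -!fmapM.
by rewrite hh.
Qed.

(** Linearity in [a] of a map out of [(x (x) y) |> a] becomes, by uncurrying,
    bilinearity of a map out of [x |> p] for [p] the algebra [y |> a]. Two
    universal maps for the same [x (x) y] and [a] then differ by an isomorphism,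
    which is what makes the associator invertible. *)
Lemma universal_comp x y a p p' (q : hom (act S y (carrier a)) (carrier p))
    (r : hom (act S x (carrier p)) (carrier p')) :
  universal q -> universal r ->
  @universal (tens V x y) a p' (r \oc (1_x |> q) \oc aassoc S x y (carrier a)).
Proof.
move=> uq ur; split.
  rewrite /bilin -!cmpA assoc_natr (cmpA (1_x |> q)) -actM (proj1 uq).
  rewrite actM !cmpA (proj1 ur) -!cmpA !fmapM -!cmpA; congr (_ \oc (_ \oc _)).
  by rewrite lax_assoc actM -!cmpA (cmp_eq _ (lax_nat _ _ _)) -!cmpA.
move=> b g bg; have [v [vu uv]] := aassoc_iso S x y (carrier a).
have [|h0 [bh hE]] := @universal_uncurry x y a p q b (g \oc v) uq.
  have [w [_ uw]] := aassoc_iso S x y (T (carrier a)).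
  rewrite -[LHS]cmpf1 -[RHS]cmpf1 -uw !cmpA; congr (_ \oc w).
  rewrite -!cmpA -assoc_natr (cmpA v) vu cmp1f bg.
  rewrite (cmpA (Ta _ _)) -(lax_assoc Ta) fmapM -!cmpA (cmpA (fmap T v)).
  by rewrite -fmapM vu fmap1 cmp1f.
have [h [hr _]] := proj2 ur b h0 bh.
exists h; split; first by rewrite !cmpA hr hE -cmpA vu cmpf1.
move=> k kg; apply: (universal_ext ur); rewrite hr.
apply: (universal_uncurry_ext uq bh (bilin_comp_alg k (proj1 ur))).
by rewrite hE -kg -!cmpA uv cmpf1.
Qed.

End Composition.

End Bilinear.

(** * Module structures on the category of algebras *)

Section ModuleStructures.
Variables (K : fieldType) (C : lincat K) (V : monoidal C) (M : lincat K).
Variables (S : modcat V M) (T : lax_modmonad S).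
Implicit Types (x y : C) (a b c p : em T).

Local Notation "f |> g" := (bmap (act S) f g) (at level 39).
Local Notation "1_ x" := (idm x) (at level 2, x at level 2, format "1_ x").
Local Notation Ta := (lmm_lax T).

Lemma universal_exists x a : abelian M -> right_exact T ->
  exists p (q : hom (act S x (carrier a)) (carrier p)), universal q.
Proof.
move=> abM rexT.
have [p [s [col _]]] := em_colimit (pair_diagram (presl x a) (presr x a)) abM rexT.
have co := colimit_coequalizer (F := idfun_cat (em T)) col.
pose e : hom (free_alg T (act S x (carrier a))) p := s true.
exists p, (alg_val e \oc eta T _); apply/universal_coequalizer.
suff -> : free_ext (alg_val e \oc eta T _) = e by [].
by apply: free_hom_ext; rewrite free_ext_eta.
Qed.

Section Construction.
Hypotheses (rexA : right_exact_right_var (act S)) (rexT : right_exact T).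
Hypothesis (rexU : right_exact (forget T)).
Variables (tob : C -> em T -> em T).
Variable q : forall x a, hom (act S x (carrier a)) (carrier (tob x a)).
Hypothesis uq : forall x a, universal (q x a).

Fact desc_subproof x a b (g : hom (act S x (carrier a)) (carrier b)) :
  bilin g -> exists h : hom (tob x a) b, alg_val h \oc q x a == g.
Proof. by move=> /(proj2 (uq x a))[h [/eqP hg _]]; exists h. Qed.

Definition desc x a b (g : hom (act S x (carrier a)) (carrier b)) (bg : bilin g)
  : hom (tob x a) b := xchoose (desc_subproof bg).

Lemma descE x a b (g : hom (act S x (carrier a)) (carrier b)) (bg : bilin g) :
  alg_val (desc bg) \oc q x a = g.
Proof. exact/eqP/(xchooseP (desc_subproof bg)). Qed.

Definition tmap x x' a a' (f : hom x x') (h : hom a a') :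
    hom (tob x a) (tob x' a') :=
  desc (bilin_comp_act f h (proj1 (uq x' a'))).

Lemma tmapE x x' a a' (f : hom x x') (h : hom a a') :
  alg_val (tmap f h) \oc q x a = q x' a' \oc (f |> alg_val h).
Proof. exact: descE. Qed.

Fact tmap_linl x x' a a' (k : K) (f f' : hom x x') (h : hom a a') :
  tmap (k *: f + f') h = k *: tmap f h + tmap f' h.
Proof.
apply: (universal_ext (uq x a)).
by rewrite [RHS]cmp_linl !tmapE bmap_linl cmp_linr.
Qed.

Fact tmap_linr x x' a a' (k : K) (f : hom x x') (h h' : hom a a') :
  tmap f (k *: h + h') = k *: tmap f h + tmap f h'.
Proof.
apply: (universal_ext (uq x a)).
by rewrite [RHS]cmp_linl !tmapE [X in _ |> X]/= bmap_linr cmp_linr.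
Qed.

Fact tmap1 x a : tmap 1_x 1_a = idm (tob x a).
Proof.
by apply: (universal_ext (uq x a)); rewrite tmapE alg_val1 bmap1 cmpf1 cmp1f.
Qed.

Fact tmapM x x' x'' a a' a'' (f' : hom x' x'') (f : hom x x') (h' : hom a' a'')
    (h : hom a a') :
  tmap (f' \oc f) (h' \oc h) = tmap f' h' \oc tmap f h.
Proof.
apply: (universal_ext (uq x a)).
by rewrite alg_valM -cmpA !tmapE cmpA tmapE -cmpA -bmapM.
Qed.

Definition tens_em : bifunctor C (em T) (em T) :=
  @Bifunctor K C (em T) (em T) tob tmap tmap_linl tmap_linr tmap1 tmapM.

Definition tassoc x y a : hom (tob (tens V x y) a) (tob x (tob y a)) :=
  desc (proj1 (universal_comp rexA rexT rexU (uq y a) (uq x (tob y a)))).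

Lemma tassocE x y a :
  alg_val (tassoc x y a) \oc q (tens V x y) a
  = q x (tob y a) \oc (1_x |> q y a) \oc aassoc S x y (carrier a).
Proof. exact: descE. Qed.

Definition tunit a : hom (tob (munit V) a) a := desc (proj1 (universal_unit a)).

Lemma tunitE a : alg_val (tunit a) \oc q (munit V) a = aunit S (carrier a).
Proof. exact: descE. Qed.

Fact tassoc_nat x x' y y' a a' (f : hom x x') (g : hom y y') (h : hom a a') :
  tassoc x' y' a' \oc tmap (bmap (tens V) f g) h
  = tmap f (tmap g h) \oc tassoc x y a.
Proof.
apply: (universal_ext (uq _ _)); rewrite !alg_valM -!cmpA tmapE tassocE.
rewrite (cmpA (alg_val (tassoc _ _ _))) tassocE -!cmpA aassoc_nat.
rewrite (cmp_eq _ (tmapE _ _)) -!cmpA; congr (_ \oc _).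
by rewrite !cmpA act_swapl act_swap tmapE.
Qed.

Fact tunit_nat a a' (h : hom a a') :
  tunit a' \oc tmap 1_(munit V) h = h \oc tunit a.
Proof.
apply: (universal_ext (uq _ _)); rewrite !alg_valM -!cmpA tmapE tunitE.
by rewrite (cmp_eq _ (tunitE _)) aunit_nat.
Qed.

Fact tassoc_iso x y a : is_iso (tassoc x y a).
Proof.
exact: universal_iso (uq _ _) (universal_comp rexA rexT rexU (uq y a) (uq x _))
  (tassocE x y a).
Qed.

Fact tunit_iso a : is_iso (tunit a).
Proof. exact: universal_iso (uq _ _) (universal_unit a) (tunitE a). Qed.

Fact tpentagon x y z a :
  tmap 1_x (tassoc y z a) \oc tassoc x (tens V y z) a \oc tmap (massoc V x y z) 1_a
  = tassoc x y (tob z a) \oc tassoc (tens V x y) z a.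
Proof.
apply: (universal_ext (uq _ _)); rewrite !alg_valM -!cmpA tmapE tassocE alg_val1.
rewrite (cmp_eq _ (tassocE _ _ _)) -!cmpA (cmp_eq _ (tmapE _ _)) -!cmpA.
rewrite (cmpA (1_x |> _)) -actM tassocE !actM.
rewrite (cmp_eq _ (tassocE _ _ _)) -!cmpA (cmp_eq _ (assoc_natr _ _ _ _)).
rewrite -!cmpA; congr (_ \oc (_ \oc (_ \oc _))).
by rewrite cmpA apentagon.
Qed.

Fact ttriangle x a :
  tmap 1_x (tunit a) \oc tassoc x (munit V) a = tmap (mrunit V x) 1_a.
Proof.
apply: (universal_ext (uq _ _)); rewrite !alg_valM -!cmpA tmapE tassocE alg_val1.
rewrite -!cmpA (cmp_eq _ (tmapE _ _)) -!cmpA (cmpA (1_x |> _)) -actM tunitE.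
by rewrite atriangle.
Qed.

Definition em_modcat : modcat V (em T) :=
  @ModCat K C V (em T) tens_em tassoc tunit tassoc_nat tunit_nat tassoc_iso
    tunit_iso tpentagon ttriangle.

Definition em_lax : lax_modfun em_modcat S (forget T) :=
  @LaxModFun K C V (em T) M em_modcat S (forget T) q
    (fun x x' a a' f h => esym (tmapE f h)) tassocE tunitE.

End Construction.

(** [L x a], with the forgetful functor unfolded in its type. *)
Definition corep (E : modcat V (em T)) (L : lax_modfun E S (forget T)) x a :
    hom (act S x (carrier a)) (carrier (act E x a)) := L x a.

(** The algebra [x |> a] corepresents the bilinear maps out of [x] and [a]; that
    the universal maps form a lax module functor says that they determine the
    action on morphisms, the associator and the unitor. *)
Definition corepresents (E : modcat V (em T)) (L : lax_modfun E S (forget T)) :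
    Prop :=
  forall x a, universal (corep L x a).

Lemma corepresenting_exists :
  abelian M -> right_exact_right_var (act S) -> right_exact T ->
  exists (E : modcat V (em T)) (L : lax_modfun E S (forget T)), corepresents L.
Proof.
move=> abM rexA rexT; have rexU := forget_right_exact abM rexT.
have P x a : {p : em T & {q : hom (act S x (carrier a)) (carrier p) | universal q}}.
  have /constructive_indefinite_description[p Pp] := universal_exists x a abM rexT.
  by exists p; apply: constructive_indefinite_description.
pose uq x a := proj2_sig (projT2 (P x a)).
by exists (em_modcat rexA rexT rexU uq), (em_lax rexA rexT rexU uq).
Qed.

Section Corepresenting.
Variables (E : modcat V (em T)) (L : lax_modfun E S (forget T)).
Hypothesis uL : corepresents L.
Local Notation corep := (corep L).

Lemma corep_nat x x' a a' (f : hom x x') (h : hom a a') :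
  alg_val (bmap (act E) f h) \oc corep x a = corep x' a' \oc (f |> alg_val h).
Proof. exact/esym/(lax_nat L). Qed.

Lemma corep_assoc x y a :
  alg_val (aassoc E x y a) \oc corep (tens V x y) a
  = corep x (act E y a) \oc (1_x |> corep y a) \oc aassoc S x y (carrier a).
Proof. exact: (lax_assoc L). Qed.

Lemma corep_unit a :
  alg_val (aunit E a) \oc corep (munit V) a = aunit S (carrier a).
Proof. exact: (lax_unit L). Qed.

(** A cocone from the [D i |> a] to [d] is a compatible family of bilinear maps
    [D i |> |a| -> |d|]. These glue to a map [c |> |a| -> |d|], which is
    bilinear because that can be tested on the legs [D i |> T |a| -> c |> T |a|]. *)
Lemma corep_right_exact_left : right_exact_left_var (act S) ->
  right_exact_left_var (act E).
Proof.
move=> rexC a J D c s col.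
have colm := rexC (carrier a) _ _ _ _ col.
have colTm := rexC (T (carrier a)) _ _ _ _ col.
apply: colimitI.
- move=> i j f; rewrite [LHS](esym (bmapM (act E) (s j) (dmap D f) 1_a 1_a)).
  by rewrite (proj1 col) cmpf1.
- move=> d t cot.
  have [|g gE] := colimit_desc colm (t := fun i => alg_val (t i) \oc corep (D i) a).
    move=> i j f; rewrite /= -cmpA -(corep_nat _ 1_a) cmpA -alg_valM.
    by rewrite [t j \oc _](cot i j f).
  have bg : @bilin K C V M S T c a d g.
    apply: (colimit_ext colTm) => i /=.
    have /= gi := gE i.
    rewrite -cmpA act_swapl cmpf1 -{1}(cmp1f (structure a)) -act_swap cmpA gi.
    rewrite [LHS](bilin_comp_alg (t i) (proj1 (uL (D i) a))).
    by rewrite -gi fmapM -!cmpA -lax_nat fmap1.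
  have [u [uE _]] := proj2 (uL c a) d g bg.
  exists u => i; apply: (universal_ext (uL (D i) a)).
  by rewrite /= -cmpA corep_nat cmpA uE; apply: gE.
move=> d u v uv; apply: (universal_ext (uL c a)).
apply: (colimit_ext colm) => i /=.
rewrite -!cmpA -(corep_nat _ 1_a) !cmpA -!alg_valM.
by congr (alg_val _ \oc _); apply: uv.
Qed.

(** The same argument, with [x |> |D i|] and [x |> T |D i|], whose colimits are
    preserved by the forgetful functor, by [T] and by [x |> -]. *)
Lemma corep_right_exact_right : right_exact_right_var (act S) ->
  right_exact T -> right_exact (forget T) -> right_exact_right_var (act E).
Proof.
move=> rexA rexT rexU x J D c s col.
have colU := rexU _ _ _ _ col.
have colm := rexA x _ _ _ _ colU.
have colTm := rexA x _ _ _ _ (rexT _ _ _ _ colU).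
apply: colimitI.
- move=> i j f; rewrite [LHS](esym (bmapM (act E) 1_x 1_x (s j) (dmap D f))).
  by rewrite (proj1 col) cmpf1.
- move=> d t cot.
  have [|g gE] := colimit_desc colm (t := fun i => alg_val (t i) \oc corep x (D i)).
    move=> i j f; rewrite /= -cmpA -(corep_nat 1_x) cmpA -alg_valM.
    by rewrite [t j \oc _](cot i j f).
  have bg : @bilin K C V M S T x c d g.
    apply: (colimit_ext colTm) => i /=.
    have /= gi := gE i.
    rewrite -!cmpA -actM -alg_homE actM cmpA gi.
    rewrite [LHS](bilin_comp_alg (t i) (proj1 (uL x (D i)))).
    by rewrite -gi lax_nat fmapM -!cmpA.
  have [u [uE _]] := proj2 (uL x c) d g bg.
  exists u => i; apply: (universal_ext (uL x (D i))).
  by rewrite /= -cmpA corep_nat cmpA uE; apply: gE.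
move=> d u v uv; apply: (universal_ext (uL x c)).
apply: (colimit_ext colm) => i /=; rewrite -!cmpA -(corep_nat 1_x) !cmpA -!alg_valM.
by congr (alg_val _ \oc _); apply: uv.
Qed.

End Corepresenting.

Lemma kleisli_incl_eta (m n : M) (f : hom m n) :
  alg_val (fmap (kleisli_incl T) (eta T n \oc f : hom (m : kleisli T) n)) = fmap T f.
Proof. by rewrite /= fmapM cmpA mu_etar cmp1f. Qed.

(** On the free algebra [T m] the map [T_a] is universal too, hence the comparison
    [x |> T m -> T (x |> m)] that it induces is invertible. *)
Lemma corep_strong (E : modcat V (em T)) (L : lax_modfun E S (forget T)) :
  corepresents L -> is_strong_modfun (kleisli_modcat T) E (kleisli_incl T).
Proof.
move=> uL.
have ex x (m : M) : {h : hom (act E x (free_alg T m)) (free_alg T (act S x m)) |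
    alg_val h \oc corep L x (free_alg T m) = Ta x m}.
  apply: constructive_indefinite_description.
  have bTa := proj1 (universal_free T x m).
  by have [h [hE _]] := proj2 (uL x (free_alg T m)) _ _ bTa; exists h.
pose l x m := proj1_sig (ex x m).
have lE x m : alg_val (l x m) \oc corep L x (free_alg T m) = Ta x m.
  exact: proj2_sig (ex x m).
have l_nat x x' (m m' : kleisli T) (f : hom x x') (g : hom m m') :
    l x' m' \oc bmap (act E) f (fmap (kleisli_incl T) g)
    = fmap (kleisli_incl T) (bmap (kl_bifunctor T) f g) \oc l x m.
  apply: (universal_ext (uL _ _)); rewrite !alg_valM -!cmpA lE.
  rewrite (corep_nat L) cmpA lE /= -act_swapl /kl_act fmapM -!cmpA -lax_nat.
  by rewrite !cmpA -mu_modtrans -!cmpA.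
have l_assoc x y (m : kleisli T) :
    fmap (kleisli_incl T) (kl_assoc x y m) \oc l (tens V x y) m
    = l x (act S y m) \oc bmap (act E) 1_x (l y m) \oc aassoc E x y (free_alg T m).
  have lE2 : alg_val (l x (act S y m)) \oc (alg_val (bmap (act E) 1_x (l y m)) \oc
      (corep L x (act E y (free_alg T m)) \oc (1_x |> corep L y (free_alg T m))))
      = Ta x (act S y m) \oc (1_x |> Ta y m).
    rewrite (cmpA (alg_val (bmap (act E) _ _))) corep_nat -cmpA -actM lE cmpA lE.
    by [].
  apply: (universal_ext (uL _ _)); rewrite !alg_valM -!cmpA lE.
  rewrite cmpA [X in X \oc _]kleisli_incl_eta (corep_assoc L).
  rewrite (lax_assoc Ta) -lE2 !cmpA.
  by [].
have l_unit (m : kleisli T) :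
    fmap (kleisli_incl T) (kl_unit m) \oc l (munit V) m = aunit E (free_alg T m).
  apply: (universal_ext (uL _ _)); rewrite !alg_valM -!cmpA lE corep_unit.
  by rewrite cmpA [X in X \oc _]kleisli_incl_eta (lax_unit Ta).
exists (@LaxModFun K C V (kleisli T) (em T) (kleisli_modcat T) E (kleisli_incl T)
  l l_nat l_assoc l_unit) => x m /=.
exact: universal_iso (uL _ _) (universal_free T x m) (lE x m).
Qed.

(** The unique isomorphisms between the algebras [x |> a] of the two structures
    that match the universal maps make the identity functor strong. *)
Lemma corep_equivalent (E1 E2 : modcat V (em T))
    (L1 : lax_modfun E1 S (forget T)) (L2 : lax_modfun E2 S (forget T)) :
  corepresents L1 -> corepresents L2 -> modcat_equivalent E1 E2.
Proof.
move=> u1 u2.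
have ex x a : {h : hom (act E2 x a) (act E1 x a) |
    alg_val h \oc corep L2 x a = corep L1 x a}.
  apply: constructive_indefinite_description.
  by have [h [hE _]] := proj2 (u2 x a) _ _ (proj1 (u1 x a)); exists h.
pose l x a := proj1_sig (ex x a).
have lE x a : alg_val (l x a) \oc corep L2 x a = corep L1 x a := proj2_sig (ex x a).
exists (idfun_cat (em T)); split.
  exists (idfun_cat (em T)).
  by split; exists (fun a => idm a); split=> [a b f|a]; rewrite ?cmp1f ?cmpf1 //;
    exists (idm a); rewrite cmp1f.
have l_nat x x' a a' (f : hom x x') (h : hom a a') :
    l x' a' \oc bmap (act E2) f h = bmap (act E1) f h \oc l x a.
  apply: (universal_ext (u2 _ _)); rewrite !alg_valM -!cmpA lE.
  by rewrite !corep_nat cmpA lE.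
have l_assoc x y a : aassoc E1 x y a \oc l (tens V x y) a
    = l x (act E1 y a) \oc bmap (act E2) 1_x (l y a) \oc aassoc E2 x y a.
  apply: (universal_ext (u2 _ _)); rewrite !alg_valM -!cmpA lE !corep_assoc.
  rewrite -!cmpA (cmp_eq _ (corep_nat L2 _ _)) -!cmpA (cmp_eq _ (lE _ _)).
  by rewrite (cmpA (1_x |> _)) -actM lE.
have l_unit a : aunit E1 a \oc l (munit V) a = aunit E2 a.
  by apply: (universal_ext (u2 _ _)); rewrite !alg_valM -!cmpA lE !corep_unit.
exists (@LaxModFun K C V (em T) (em T) E1 E2 (idfun_cat (em T))
  l l_nat l_assoc l_unit) => x a.
exact: universal_iso (u2 _ _) (u1 _ _) (lE x a).
Qed.

(** * Uniqueness *)

Section StrongInclusion.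
Variable E : modcat V (em T).
Hypothesis rexE : right_exact_right_var (act E).
Variable inclS : lax_modfun (kleisli_modcat T) E (kleisli_incl T).
Variable incl_inv :
  forall x (m : M), hom (free_alg T (act S x m)) (act E x (free_alg T m)).

Definition incl_lax x (m : M) :
    hom (act E x (free_alg T m)) (free_alg T (act S x m)) := inclS x m.

Hypothesis incl_invK :
  forall x m, incl_lax x m \oc incl_inv x m = idm (free_alg T (act S x m)).
Hypothesis incl_laxK :
  forall x m, incl_inv x m \oc incl_lax x m = idm (act E x (free_alg T m)).

Lemma incl_inv_nat x x' (m m' : kleisli T) (f : hom x x') (g : hom m m') :
  bmap (act E) f (incl_map g) \oc incl_inv x m
  = incl_inv x' m' \oc incl_map (bmap (kl_bifunctor T) f g).
Proof.
rewrite -[LHS]cmp1f -incl_laxK -!cmpA; congr (_ \oc _).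
rewrite cmpA [X in X \oc _](lax_nat inclS) -cmpA [X in _ \oc X]incl_invK.
exact: cmpf1.
Qed.

Lemma incl_inv_assoc x y (m : M) :
  aassoc E x y (free_alg T m) \oc incl_inv (tens V x y) m
  = bmap (act E) 1_x (incl_inv y m) \oc incl_inv x (act S y m)
      \oc incl_map (kl_assoc x y m).
Proof.
have inv_laxK : bmap (act E) 1_x (incl_inv y m) \oc incl_inv x (act S y m) \oc
    (incl_lax x (act S y m) \oc bmap (act E) 1_x (incl_lax y m)) = idm _.
  rewrite -cmpA (cmp_eq _ (incl_laxK _ _)) cmp1f -bmapM incl_laxK cmp1f.
  exact: bmap1.
have lassoc : incl_map (kl_assoc x y m) \oc incl_lax (tens V x y) m
    = incl_lax x (act S y m) \oc bmap (act E) 1_x (incl_lax y m)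
        \oc aassoc E x y (free_alg T m) := lax_assoc inclS x y m.
rewrite -[LHS]cmp1f -inv_laxK -[LHS]cmpA (cmpA (_ \oc _) (aassoc _ _ _ _)) -lassoc.
by rewrite -[X in _ \oc X]cmpA incl_invK cmpf1.
Qed.

Lemma incl_inv_unit (m : M) :
  aunit E (free_alg T m) \oc incl_inv (munit V) m = incl_map (kl_unit m).
Proof.
have lunit : incl_map (kl_unit m) \oc incl_lax (munit V) m
    = aunit E (free_alg T m) := lax_unit inclS m.
by rewrite -lunit -cmpA incl_invK cmpf1.
Qed.

(** The composite [x |> |a| -> T (x |> |a|) -> x |> T |a| -> x |> a] of the unit
    of [T], the inverse of the structure map of the inclusion, and [x |> -]
    applied to the counit of [a]. *)
Definition incl_univ x a : hom (act S x (carrier a)) (carrier (act E x a)) :=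
  alg_val (bmap (act E) 1_x (counit a) \oc incl_inv x (carrier a)) \oc eta T _.

Lemma incl_univ_ext x a :
  free_ext (incl_univ x a) = bmap (act E) 1_x (counit a) \oc incl_inv x (carrier a).
Proof. by apply: free_hom_ext; rewrite free_ext_eta. Qed.

Lemma incl_univ_nat x x' a a' (f : hom x x') (h : hom a a') :
  incl_univ x' a' \oc (f |> alg_val h)
  = alg_val (bmap (act E) f h) \oc incl_univ x a.
Proof.
rewrite /incl_univ -cmpA.
pose k := bmap (kl_bifunctor T) f
  (eta T _ \oc alg_val h : hom (carrier a : kleisli T) (carrier a')).
have -> : eta T _ \oc (f |> alg_val h) = alg_val (incl_map k) \oc eta T _.
  by rewrite /k /= kl_act_eta -cmpA -eta_nat cmpA mu_etal cmp1f.
transitivity (alg_val (bmap (act E) 1_x' (counit a') \oc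
    (incl_inv x' (carrier a') \oc incl_map k)) \oc eta T (act S x (carrier a))).
  by rewrite !alg_valM -!cmpA.
rewrite [RHS]cmpA -alg_valM; congr (alg_val _ \oc _).
rewrite /k -incl_inv_nat !cmpA -!bmapM cmp1f cmpf1; congr (bmap (act E) f _ \oc _).
apply: em_ext; rewrite !alg_valM /= fmapM (cmpA (mu T _)) mu_etar cmp1f.
by rewrite alg_homE.
Qed.

(** The counit of a free algebra is the image of a Kleisli morphism, on which the
    strength of the inclusion computes [x |> -] through [T_a]. *)
Lemma incl_univ_free x (m : M) :
  incl_univ x (free_alg T m) = alg_val (incl_inv x m) \oc Ta x m.
Proof.
rewrite /incl_univ.
have -> : counit (free_alg T m) = incl_map (idm (T m) : hom (T m : kleisli T) m).
  by apply: em_ext; rewrite /= fmap1 cmpf1.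
rewrite incl_inv_nat alg_valM -cmpA; congr (_ \oc _).
by rewrite /= /kl_act bmap1 cmpf1 -cmpA -eta_nat cmpA mu_etal cmp1f.
Qed.

(** [x |> -] preserves the presentation of [a] by free algebras, and the inverse
    structure maps identify the image of this presentation with [presl] and
    [presr]. *)
Lemma incl_univ_universal x a : universal (incl_univ x a).
Proof.
apply/universal_coequalizer; rewrite incl_univ_ext.
have inv_iso y m : is_iso (incl_inv y m) by exists (incl_lax y m).
have co := right_exact_coequalizer (rexE x) (counit_coequalizer a).
by apply: (coequalizer_iso co);
  [exact: inv_iso.. | exact: incl_inv_nat | exact: incl_inv_nat].
Qed.

Lemma incl_univ_assoc x y a :
  alg_val (aassoc E x y a) \oc incl_univ (tens V x y) a
  = incl_univ x (act E y a) \oc (1_x |> incl_univ y a) \oc aassoc S x y (carrier a).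
Proof.
rewrite {3}/incl_univ actM (cmpA (incl_univ _ _)) incl_univ_nat incl_univ_free.
rewrite -!cmpA (cmpA (Ta _ _)) -eta_modtrans /incl_univ.
pose k := kl_assoc x y (carrier a : kleisli T).
have -> : eta T _ \oc aassoc S x y (carrier a) = alg_val (incl_map k) \oc eta T _.
  by rewrite /k /= /kl_assoc -cmpA -eta_nat cmpA mu_etal cmp1f.
have assoc_inv :
    aassoc E x y a \oc
      (bmap (act E) 1_(tens V x y) (counit a) \oc incl_inv (tens V x y) _)
    = bmap (act E) 1_x (bmap (act E) 1_y (counit a) \oc incl_inv y _)
        \oc incl_inv x _ \oc incl_map k.
  rewrite cmpA -(bmap1 (tens V)) aassoc_nat -cmpA incl_inv_assoc !cmpA.
  by rewrite -bmapM cmp1f.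
rewrite [LHS]cmpA -alg_valM assoc_inv.
by rewrite !alg_valM -!cmpA.
Qed.

Lemma incl_univ_unit a :
  alg_val (aunit E a) \oc incl_univ (munit V) a = aunit S (carrier a).
Proof.
have unitE : alg_val (incl_map (kl_unit (carrier a : kleisli T)))
    = fmap T (aunit S (carrier a)) := kleisli_incl_eta _.
rewrite /incl_univ cmpA -alg_valM cmpA aunit_nat -cmpA incl_inv_unit alg_valM unitE.
by rewrite -cmpA -eta_nat cmpA alg_unit cmp1f.
Qed.

Lemma strong_corep : exists L : lax_modfun E S (forget T), corepresents L.
Proof.
exists (@LaxModFun K C V (em T) M E S (forget T) incl_univ
  incl_univ_nat incl_univ_assoc incl_univ_unit).
exact: incl_univ_universal.
Qed.

End StrongInclusion.

Lemma strong_incl_corep (E : modcat V (em T)) :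
  right_exact_right_var (act E) ->
  is_strong_modfun (kleisli_modcat T) E (kleisli_incl T) ->
  exists L : lax_modfun E S (forget T), corepresents L.
Proof.
move=> rexE [I isoI].
have inv x (m : M) : {J : hom (free_alg T (act S x m)) (act E x (free_alg T m)) |
    J \oc incl_lax I x m = idm _ /\ incl_lax I x m \oc J = idm _}.
  exact: constructive_indefinite_description (isoI x m).
exact: (strong_corep rexE (incl_inv := fun x m => proj1_sig (inv x m))
  (fun x m => proj2 (proj2_sig (inv x m)))
  (fun x m => proj1 (proj2_sig (inv x m)))).
Qed.

End ModuleStructures.

Theorem mainTheorem14 (K : fieldType)
    (C : lincat K) (V : monoidal C) (abC : abelian C)
    (M : lincat K) (S : modcat V M) (abM : abelian M)
    (rexC : right_exact_left_var (act S)) (rexM : right_exact_right_var (act S))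
    (T : lax_modmonad S) (rexT : right_exact T) :
  (exists E : modcat V (em T),
     [/\ right_exact_left_var (act E), right_exact_right_var (act E)
       & is_strong_modfun (kleisli_modcat T) E (kleisli_incl T)]) /\
  (forall E1 E2 : modcat V (em T),
     right_exact_right_var (act E1) -> right_exact_right_var (act E2) ->
     is_strong_modfun (kleisli_modcat T) E1 (kleisli_incl T) ->
     is_strong_modfun (kleisli_modcat T) E2 (kleisli_incl T) ->
     modcat_equivalent E1 E2).
Proof.
split.
  have [E [L uL]] := corepresenting_exists abM rexM rexT.
  exists E; split; last exact: corep_strong uL.
    exact: corep_right_exact_left uL rexC.
  exact: corep_right_exact_right uL rexM rexT (forget_right_exact abM rexT).
move=> E1 E2 rex1 rex2 str1 str2.
have [L1 u1] := strong_incl_corep rex1 str1.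
have [L2 u2] := strong_incl_corep rex2 str2.
exact: corep_equivalent u1 u2.
Qed.
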